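(* Assume that the standing assumptions (i)-(iv) of the context hold and that $c\in C^{\alpha/2,\alpha}_{\rm loc}(I\times\mathbb R^d)$ with $c_0:=\inf_{I\times\mathbb R^d}c>-\infty$. If $G(t,s)$ is supercontractive (resp. ultrabounded, resp. ultracontractive), then $G_c(t,s)$ is supercontractive (resp. ultrabounded, resp. ultracontractive) and $$\|G_c(t,s)\|_{p\to q}\le C_{p,q}(t-s)\,e^{-c_0(t-s)}$$ for any $t>s$, $1<p<q<+\infty$ (resp. $1<p<q=+\infty$, resp. $1\le p<q=+\infty$), where $C_{p,q}$ is the function given in the definition of supercontractivity (resp. ultraboundedness, resp. ultracontractivity) of $G(t,s)$.
   Context: Setting. $I$ is an open right halfline, and for $t\in I$, $(\mathcal A(t)\zeta)(x)=\mathrm{Tr}(Q(t)D^2\zeta(x))+\langle b(t,x),\nabla\zeta(x)\rangle$, $x\in\mathbb R^d$, where $Q=[q_{ij}]$ and $b=(b_1,\dots,b_d)$. Standing assumptions: (i) for some $\alpha\in(0,1)$, $q_{ij}\in C^{\alpha/2}_{\rm loc}(I)$ and $b_i\in C^{\alpha/2,\alpha}_{\rm loc}(I\times\mathbb R^d)$ (locally parabolic H\''older); (ii) $Q(t)$ is symmetric for every $t\in I$ and there are $0<\eta_0<\Lambda$ with $\eta_0|\xi|^2\le\langle Q(t)\xi,\xi\rangle\le\Lambda|\xi|^2$ for all $t\in I$, $\xi\in\mathbb R^d$; (iii) there are a positive $\varphi\in C^2(\mathbb R^d)$ with $\varphi(x)\to+\infty$ as $|x|\to+\infty$ and constants $a,\gamma>0$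 with $(\mathcal A(t)\varphi)(x)\le a-\gamma\varphi(x)$ for all $(t,x)\in I\times\mathbb R^d$; (iv) the first order spatial derivatives of $b_i$ exist and belong to $C^{\alpha/2,\alpha}_{\rm loc}(I\times\mathbb R^d)$, and there is $r_0<0$ with $\langle\nabla_xb(t,x)\xi,\xi\rangle\le r_0|\xi|^2$ for all $(t,x)\in I\times\mathbb R^d$, $\xi\in\mathbb R^d$. For $s\in I$ and $f\in C_b(\mathbb R^d)$, $G(\cdot,s)f\in C_b([s,+\infty)\times\mathbb R^d)\cap C^{1+\alpha/2,2+\alpha}_{\rm loc}((s,+\infty)\times\mathbb R^d)$ denotes the unique bounded classical solution of $D_tu=\mathcal A(t)u$ in $(s,+\infty)\times\mathbb R^d$, $u(s,\cdot)=f$. Under the standing assumptions there is a unique family $\{\mu_t:t\in I\}$ of Borel probability measures which is tight (for every $\varepsilon>0$ there is $R>0$ with $\mu_t(B(0,R))\ge1-\varepsilon$ for all $t\in I$, $B(0,R)$ being the ball of center $0$ and radius $R$) and satisfies $\int_{\mathbb R^d}G(t,s)f\,d\mu_t=\int_{\mathbb R^d}f\,d\mu_s$ for all $t>s$ in $I$, $f\in C_b(\mathbb R^d)$ (the tight evolution system of measures). $G(t,s)$ extends to a contraction from $L^p(\mathbb R^d,\mu_s)$ to $L^p(\mathbb R^d,\mu_t)$ for every $p\in[1,+\infty)$, still denoted $G(t,s)$. $\|T\|_{p\to q}$ is the operator norm from $L^p(\mathbb R^d,\mu_s)$ to $L^q(\mathbb R^d,\mu_t)$ (to $L^\infty(\mathbb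 R^d)$ with the sup-norm if $q=+\infty$). With $(\mathcal A_c(t)\zeta)(x)=(\mathcal A(t)\zeta)(x)-c(t,x)\zeta(x)$ and $c$ as in the claim, for $f\in C_b(\mathbb R^d)$ and $s\in I$, $G_c(\cdot,s)f\in C([s,+\infty)\times\mathbb R^d)\cap C^{1+\alpha/2,2+\alpha}_{\rm loc}((s,+\infty)\times\mathbb R^d)$ denotes the unique solution $u$ of $D_tu=\mathcal A_c(t)u$ in $(s,+\infty)\times\mathbb R^d$, $u(s,\cdot)=f$, satisfying $\|u(t,\cdot)\|_\infty\le e^{-c_0(t-s)}\|f\|_\infty$; $G_c(t,s)$ is the associated evolution operator, extended to $L^p(\mathbb R^d,\mu_s)$ by density of $C_b(\mathbb R^d)$. Definitions. Let $U(t,s)$ denote $G(t,s)$ or $G_c(t,s)$. $U(t,s)$ is supercontractive if it maps $L^p(\mathbb R^d,\mu_s)$ into $L^q(\mathbb R^d,\mu_t)$ for any $1<p<q<+\infty$ and $t>s$, and there exists a positive decreasing function $C_{p,q}:(0,+\infty)\to(0,+\infty)$ such that $\lim_{r\to0^+}C_{p,q}(r)=+\infty$ and $\|U(t,s)\|_{p\to q}\le C_{p,q}(t-s)$ for all $s<t$ in $I$. It is ultrabounded if it maps $L^p(\mathbb R^d,\mu_s)$ into $L^\infty(\mathbb R^d)$ for every $p>1$ and $t>s$, and there exists a decreasing function $C_{p,\infty}:(0,+\infty)\to(0,+\infty)$ such that $\lim_{r\to0^+}C_{p,\infty}(r)=+\infty$ and $\|U(t,s)\|_{p\to\infty}\le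 C_{p,\infty}(t-s)$ for all $s<t$ in $I$. It is ultracontractive if it maps $L^p(\mathbb R^d,\mu_s)$ into $L^\infty(\mathbb R^d)$ for every $p\ge1$ and $t>s$ and the last estimate holds for every $p\ge1$.
   Formalization: For c_0<0 the claim that G_c is supercontractive (resp. ultrabounded, ultracontractive) fails (c=-1: G_c(t,s)1=e^{t-s}, no decreasing rate); it is stated for c_0>=0, and for every c_0 with t-s bounded. The norm estimate is stated in full. *)

(* Defs.v *)
From HB Require Import structures.
From mathcomp Require Import all_boot all_order all_algebra.
From mathcomp Require Import all_classical all_reals all_analysis.
Import Order.TTheory GRing.Theory Num.Theory.
Import numFieldNormedType.Exports.

Set Implicit Arguments.
Unset Strict Implicit.
Unset Printing Implicit Defensive.

Local Open Scope classical_set_scope.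
Local Open Scope ring_scope.

Section Euclidean.
Context {R : realType} {d : nat}.
Local Notation Rd := 'rV[R]_d.

Definition dot (x y : Rd) : R := \sum_i x 0 i * y 0 i.

(* The library norm of ['rV[R]_d] is the sup norm; this is the Euclidean one. *)
Definition enorm (x : Rd) : R := Num.sqrt (dot x x).

Definition basis_vec (i : 'I_d) : Rd := delta_mx 0 i.

Definition partial (i : 'I_d) (f : Rd -> R) : Rd -> R := 'D_(basis_vec i) f.

Definition gradient (f : Rd -> R) (x : Rd) : Rd := \row_i partial i f x.

Definition hessian (f : Rd -> R) (x : Rd) : 'M[R]_d :=
  \matrix_(i, j) partial i (partial j f) x.

Definition partials_exist (f : Rd -> R) : Prop :=
  forall i x, derivable f x (basis_vec i).

Definition C2 (f : Rd -> R) : Prop :=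
  [/\ continuous f,
      partials_exist f,
      forall i, continuous (partial i f),
      forall i, partials_exist (partial i f) &
      forall i j, continuous (partial i (partial j f))].

Definition Cb (f : Rd -> R) : Prop :=
  continuous f /\ exists M, forall x, `|f x| <= M.

Definition sup_norm (f : Rd -> R) : \bar R :=
  ereal_sup [set (`|f x|)%:E | x in [set: Rd]].

End Euclidean.

Notation borelRd R d := (g_sigma_algebraType (@open 'rV[R]_d)).

(* [i0] is the left endpoint of an open halfline ]i0, +oo[. *)
Section Holder.
Context {R : realType} {d : nat}.
Local Notation Rd := 'rV[R]_d.

Definition holder_loc (i0 beta : R) (f : R -> R) : Prop :=
  forall K : set R, compact K -> K `<=` [set t | i0 < t] ->
  exists M : R, forall t t', K t -> K t' ->
    `|f t - f t'| <= M * `|t - t'| `^ beta.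

(* C^(alpha/2, alpha)_loc on ]i0, +oo[ x R^d *)
Definition parabolic_holder_loc (i0 alpha : R) (u : R -> Rd -> R) : Prop :=
  forall K : set (R * Rd), compact K -> K `<=` [set z | i0 < z.1] ->
  exists M : R, forall z z', K z -> K z' ->
    `|u z.1 z.2 - u z'.1 z'.2| <=
      M * (`|z.1 - z'.1| `^ (alpha / 2) + enorm (z.2 - z'.2) `^ alpha).

Definition time_deriv (u : R -> Rd -> R) (t : R) (x : Rd) : R :=
  derive1 (fun r => u r x) t.

(* C^(1 + alpha/2, 2 + alpha)_loc on ]i0, +oo[ x R^d *)
Definition parabolic_C12_holder_loc (i0 alpha : R) (u : R -> Rd -> R) : Prop :=
  [/\ parabolic_holder_loc i0 alpha u,
      (forall t x, i0 < t -> derivable (fun r => u r x) t 1) /\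
        parabolic_holder_loc i0 alpha (time_deriv u),
      forall i, (forall t, i0 < t -> partials_exist (u t)) /\
        parabolic_holder_loc i0 alpha (fun t => partial i (u t)) &
      forall i j, (forall t, i0 < t -> partials_exist (partial j (u t))) /\
        parabolic_holder_loc i0 alpha (fun t => partial i (partial j (u t)))].

End Holder.

Section Parabolic.
Context {R : realType} {d : nat}.
Local Notation Rd := 'rV[R]_d.

Definition opA (Q : R -> 'M[R]_d) (b : R -> Rd -> Rd) (t : R) (f : Rd -> R)
    (x : Rd) : R :=
  \tr (Q t *m hessian f x) + dot (b t x) (gradient f x).

Definition opAc (Q : R -> 'M[R]_d) (b : R -> Rd -> Rd) (c : R -> Rd -> R)
    (t : R) (f : Rd -> R) (x : Rd) : R :=
  opA Q b t f x - c t x * f x.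

Record standing_assumptions (i0 alpha : R) (Q : R -> 'M[R]_d)
    (b : R -> Rd -> Rd) : Prop := {
  sa_alpha : 0 < alpha < 1 ;
  sa_Q_holder : forall i j, holder_loc i0 (alpha / 2) (fun t => Q t i j) ;
  sa_b_holder : forall i,
    parabolic_holder_loc i0 alpha (fun t x => b t x 0 i) ;
  sa_Q_sym : forall t, i0 < t -> (Q t)^T = Q t ;
  sa_elliptic : exists eta0 Lambda : R, 0 < eta0 < Lambda /\
    forall t (xi : Rd), i0 < t ->
      eta0 * enorm xi ^+ 2 <= dot (xi *m (Q t)^T) xi <= Lambda * enorm xi ^+ 2 ;
  sa_lyapunov : exists phi : Rd -> R,
    [/\ C2 phi, forall x, 0 < phi x,
        forall M : R, exists rho : R, forall x, rho < enorm x -> M < phi x &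
        exists a gamma : R, [/\ 0 < a, 0 < gamma &
          forall t x, i0 < t -> opA Q b t phi x <= a - gamma * phi x]] ;
  sa_b_deriv : forall i,
    (forall t, i0 < t -> partials_exist (fun y => b t y 0 i)) /\
    forall j, parabolic_holder_loc i0 alpha
      (fun t => partial j (fun y => b t y 0 i)) ;
  sa_dissipative : exists2 r0 : R, r0 < 0 &
    forall t x (xi : Rd), i0 < t ->
      \sum_i \sum_j partial j (fun y => b t y 0 i) x * xi 0 j * xi 0 i
        <= r0 * enorm xi ^+ 2 }.

(* [u] is continuous on [s, +oo[ x R^d, has the interior parabolic Hoelder
   regularity, and solves D_t u = L(t) u for t > s with u(s, .) = f. *)
Definition classical_solution (alpha : R) (L : R -> (Rd -> R) -> Rd -> R)
    (s : R) (f : Rd -> R) (u : R -> Rd -> R) : Prop :=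
  [/\ {within [set z : R * Rd | s <= z.1],
         continuous (fun z : R * Rd => u z.1 z.2)},
      parabolic_C12_holder_loc s alpha u,
      forall t x, s < t -> time_deriv u t x = L t (u t) x &
      forall x, u s x = f x].

(* An evolution operator takes [t] first: [G t s f] is G(t,s)f. *)
Definition is_evolution_G (i0 alpha : R) (Q : R -> 'M[R]_d)
    (b : R -> Rd -> Rd) (G : R -> R -> (Rd -> R) -> Rd -> R) : Prop :=
  forall s f, i0 < s -> Cb f ->
    classical_solution alpha (opA Q b) s f (fun t => G t s f) /\
    exists M : R, forall t x, s <= t -> `|G t s f x| <= M.

Definition is_evolution_Gc (i0 alpha : R) (Q : R -> 'M[R]_d)
    (b : R -> Rd -> Rd) (c : R -> Rd -> R) (c0 : R)
    (Gc : R -> R -> (Rd -> R) -> Rd -> R) : Prop :=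
  forall s f, i0 < s -> Cb f ->
    classical_solution alpha (opAc Q b c) s f (fun t => Gc t s f) /\
    forall t, s <= t ->
      (sup_norm (Gc t s f) <= (expR (- c0 * (t - s)))%:E * sup_norm f)%E.

Definition tight_evolution_system (i0 : R)
    (G : R -> R -> (Rd -> R) -> Rd -> R)
    (mu : R -> probability (borelRd R d) R) : Prop :=
  (forall eps : R, 0 < eps -> exists2 rho : R, 0 < rho &
     forall t, i0 < t -> ((1 - eps)%:E <= mu t [set x | (enorm x < rho)%R])%E)
  /\
  (forall s t f, i0 < s -> s < t -> Cb f ->
     (\int[mu t]_x (G t s f x)%:E = \int[mu s]_x (f x)%:E)%E).

End Parabolic.

Section LpExtension.
Context {R : realType} {d : nat}.
Local Notation Rd := 'rV[R]_d.
Implicit Types (mu nu : probability (borelRd R d) R) (T : (Rd -> R) -> Rd -> R).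

Definition Lp_cvg mu (p : R) (h : nat -> Rd -> R) (f : Rd -> R) : Prop :=
  Lnorm mu p%:E (fun x => (h n x - f x)%:E) @[n --> \oo] --> 0%E.

(* [g] is a representative of the value at [f] of the extension of [T] by
   density from C_b to a map from L^p(mu) to L^p(nu). *)
Definition Lp_extension mu nu (p : R) T (f g : Rd -> R) : Prop :=
  [/\ (f : borelRd R d -> R) \in Lfun mu p%:E,
      (g : borelRd R d -> R) \in Lfun nu p%:E,
      exists2 h, (forall n, Cb (h n)) & Lp_cvg mu p h f &
      forall h, (forall n, Cb (h n)) -> Lp_cvg mu p h f ->
        Lp_cvg nu p (fun n => T (h n)) g].

Definition maps_Lp_Lq mu nu (p : R) (q : \bar R) T : Prop :=
  forall f, (f : borelRd R d -> R) \in Lfun mu p%:E ->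
    exists2 g, Lp_extension mu nu p T f g &
      (g : borelRd R d -> R) \in Lfun nu q.

(* For q = +oo the target norm is the nu-essential sup-norm, since [g] is only
   defined up to nu-null sets. *)
Definition op_norm mu nu (p : R) (q : \bar R) T : \bar R :=
  ereal_sup [set y | exists f g,
    [/\ (Lnorm mu p%:E (EFin \o f) <= 1)%E, Lp_extension mu nu p T f g &
        y = Lnorm nu q (EFin \o g)]].

End LpExtension.
Arguments Lp_cvg {R d}.
Arguments Lp_extension {R d}.
Arguments maps_Lp_Lq {R d}.
Arguments op_norm {R d}.

Section Contractivity.
Context {R : realType} {d : nat}.
Local Notation Rd := 'rV[R]_d.

(* [tau] is a time horizon: [C] is decreasing (in the weak sense) on ]0, tau[. *)
Definition rate_function (tau : \bar R) (C : R -> R) : Prop :=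
  [/\ forall r, 0 < r -> 0 < C r,
      forall r r', 0 < r -> r <= r' -> (r'%:E < tau)%E -> C r' <= C r &
      C r @[r --> 0^'+] --> +oo].

Definition supercontractive_exp (p : R) (q : \bar R) : Prop :=
  [/\ 1 < p, (p%:E < q)%E & (q < +oo)%E].

Definition ultrabounded_exp (p : R) (q : \bar R) : Prop :=
  1 < p /\ q = +oo%E.

Definition ultracontractive_exp (p : R) (q : \bar R) : Prop :=
  1 <= p /\ q = +oo%E.

(* For all exponents in the range [E], [U] satisfies the L^p-L^q estimate with
   rate [C p q] for all s < t in ]i0, +oo[ with t - s < tau. *)
Definition contractive_with (E : R -> \bar R -> Prop) (i0 : R)
    (mu : R -> probability (borelRd R d) R) (tau : \bar R)
    (U : R -> R -> (Rd -> R) -> Rd -> R) (C : R -> \bar R -> R -> R) : Prop :=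
  forall p q, E p q -> rate_function tau (C p q) /\
    forall s t, i0 < s -> s < t -> ((t - s)%:E < tau)%E ->
      maps_Lp_Lq (mu s) (mu t) p q (U t s) /\
      (op_norm (mu s) (mu t) p q (U t s) <= (C p q (t - s))%:E)%E.

Definition contractive_upto E i0 mu tau U : Prop :=
  exists C, contractive_with E i0 mu tau U C.

Definition supercontractive i0 mu U : Prop :=
  contractive_upto supercontractive_exp i0 mu +oo%E U.
Definition ultrabounded i0 mu U : Prop :=
  contractive_upto ultrabounded_exp i0 mu +oo%E U.
Definition ultracontractive i0 mu U : Prop :=
  contractive_upto ultracontractive_exp i0 mu +oo%E U.

(* Variants over bounded time steps t - s. They are needed for [Gc] when
   c0 < 0: if c = c0 is constant then Gc(t,s)1 = exp(-c0 (t - s)) is unbounded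
   in t - s, so no decreasing rate can hold on the whole of ]0, +oo[. *)
Definition locally_supercontractive i0 mu U : Prop :=
  forall T : R, contractive_upto supercontractive_exp i0 mu T%:E U.
Definition locally_ultrabounded i0 mu U : Prop :=
  forall T : R, contractive_upto ultrabounded_exp i0 mu T%:E U.
Definition locally_ultracontractive i0 mu U : Prop :=
  forall T : R, contractive_upto ultracontractive_exp i0 mu T%:E U.

(* [U] satisfies, for all exponents in [E] and all s < t in ]i0, +oo[, the
   L^p-L^q bound with constant [K p q (t - s)]. *)
Definition norm_bound (E : R -> \bar R -> Prop) (i0 : R)
    (mu : R -> probability (borelRd R d) R)
    (U : R -> R -> (Rd -> R) -> Rd -> R) (K : R -> \bar R -> R -> R) : Prop :=
  forall p q s t, E p q -> i0 < s -> s < t ->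
    maps_Lp_Lq (mu s) (mu t) p q (U t s) /\
    (op_norm (mu s) (mu t) p q (U t s) <= (K p q (t - s))%:E)%E.

End Contractivity.

(* Main.v *)
Require Import Defs.
From mathcomp Require Import all_boot all_order all_algebra.
From mathcomp Require Import all_classical all_reals all_analysis.
From mathcomp Require Import measurable_realfun ess_sup_inf.
From mathcomp Require Import ring lra.
Import Order.TTheory GRing.Theory Num.Theory.
Import numFieldNormedType.Exports.

(** The perturbed evolution operator is dominated pointwise by the unperturbed one:
    for [f1], [f2] bounded and continuous,
      [|Gc(t,s) f1 - Gc(t,s) f2| <= e^{-c0 (t-s)} G(t,s) |f1 - f2|]
    ([evolution_comparison]).  Indeed, with [w = Gc(t,s) f1 - Gc(t,s) f2] and
    [v = G(t,s) |f1 - f2|], the function [z = e^{c0 (t-s)} w - v] starts from a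
    nonpositive value and satisfies
      [D_t z = A z + e^{c0 (t-s)} (c0 - c) w].
    Since [v >= 0], the inequality [z > 0] forces [w > 0], hence [D_t z <= A z] on
    the set where [z] is positive, which is all that the maximum principle needs.

    The maximum principle on the unbounded domain ([maximum_principle]) uses the
    Lyapunov function [phi] as a barrier.  It reduces to the fact that a
    second-order elliptic operator is nonpositive at a maximum
    ([opA_at_max_le0]): the Hessian is negative semidefinite there, which takes
    derivatives in all directions and so the formula
    [D_v f = sum_i v_i D_i f] for continuous partial derivatives
    ([is_derive_partials]), and the trace of a product of a positive and a
    negative semidefinite matrix is nonpositive ([trace_psd_nsd_le0]).

    What remains is measure theoretic.  An operator [U] on bounded continuous
    functions dominated as above by [k S], where [S] extends from [L^p(mu)] to
    [L^p(nu)] with values in [L^q(nu)], inherits the extension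
    ([dominated_maps_Lp_Lq]): it sends an approximating sequence of [f] to a Cauchy
    sequence, whose limit exists because [L^p] is complete ([Lp_complete]).  The
    domination passes to the limit, so that the extensions satisfy
    [|U f| <= k S |f|] almost everywhere ([extension_dominated]).  Taking norms in
    [L^q] bounds the norm of [U] by [k] times that of [S]
    ([dominated_op_norm_le]), and [k = e^{-c0 (t-s)}] is the claim. *)

Set Implicit Arguments.
Unset Strict Implicit.
Unset Printing Implicit Defensive.

Local Open Scope classical_set_scope.
Local Open Scope ring_scope.

(** * Directional derivatives *)

Section DirectionalDerivatives.
Context {R : realType} {V : normedModType R}.
Implicit Types (f g : V -> R) (x y u v : V).

Lemma is_derive_line f y v r df :
  is_derive (y + r *: v) v f df <-> is_derive r (1 : R) (fun h => f (y + h *: v)) df.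
Proof.
have E : (fun h : R => h^-1 *: (((fun k : R => f (y + k *: v)) \o shift r) (h *: (1 : R))
                                - f (y + r *: v)))
       = (fun h : R => h^-1 *: ((f \o shift (y + r *: v)) (h *: v) - f (y + r *: v))).
  apply/funext => h /=; congr (_ *: (f _ - _)).
  by rewrite [h%:A]mulr1 scalerDl addrCA.
by split=> -[dfx dfE]; apply: DeriveDef;
  rewrite /derivable /derive ?E// -?E// -dfE /derive ?E// -?E.
Qed.

Lemma mvt_direction f y v : (forall z, derivable f z v) ->
  exists2 th : R, 0 < th < 1 & f (y + v) - f y = 'D_v f (y + th *: v).
Proof.
move=> df.
have dg (r : R) : is_derive r (1 : R) (fun h => f (y + h *: v)) ('D_v f (y + r *: v)).
  exact/is_derive_line/derivableP.
have cg : {within `[0, 1], continuous (fun h : R => f (y + h *: v))}.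
  apply: continuous_subspaceT => r.
  by apply: differentiable_continuous; apply/derivable1_diffP; case: (dg r).
have [th thI] := @MVT R (fun h => f (y + h *: v)) (fun r => 'D_v f (y + r *: v)) 0 1
  ltr01 (fun r _ => dg r) cg.
rewrite scale1r scale0r addr0 subr0 mulr1 => E; exists th => //.
Qed.

Lemma is_derive_scale_dir f x v (k : R) df :
  is_derive x v f df -> is_derive x (k *: v) f (k * df).
Proof.
move=> dfx.
have /(is_derive_line _ _ _ _ _).2 : is_derive (0 : R) (1 : R) (fun h => f (x + h *: (k *: v))) (k * df); last first.
  by rewrite scale0r addr0.
have dg : is_derive (k * 0) (1 : R) (fun h => f (x + h *: v)) df.
  by apply/is_derive_line; rewrite mulr0 scale0r addr0.
have dk : is_derive (0 : R) (1 : R) (fun h : R => k * h) k.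
  by apply: is_derive_eq; rewrite [LHS]mulr1.
have := @is_derive1_comp R (fun h => f (x + h *: v)) (fun h : R => k * h) 0 _ _ dg dk.
rewrite mulrC => H; congr (is_derive _ _ _ _): H.
by apply/funext => h /=; rewrite scalerA mulrC.
Qed.

(** The increment along [u + v] splits as an increment along [u] based at a
    moving point plus one along [v]; the mean value theorem turns the first into
    a value of ['D_u f] near [x], whose continuity fixes the limit. *)
Lemma is_deriveD_dir f x u v df :
  (forall z, derivable f z u) -> {for x, continuous ('D_u f)} ->
  is_derive x v f df -> is_derive x (u + v) f ('D_u f x + df).
Proof.
move=> du cu [dv dvE].
suff H : h^-1 *: ((f \o shift x) (h *: (u + v)) - f x) @[h --> 0^'] --> 'D_u f x + df.
  apply: DeriveDef; first by apply/cvg_ex; exists ('D_u f x + df).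
  exact: (cvg_lim _ H).
have Hv : h^-1 *: ((f \o shift x) (h *: v) - f x) @[h --> 0^'] --> df.
  by rewrite -dvE; exact: dv.
have Hu : h^-1 *: (f (h *: u + (h *: v + x)) - f (h *: v + x)) @[h --> 0^'] --> 'D_u f x.
  apply/cvgrPdist_lt => e e0.
  move/cvgrPdist_lt: cu => /(_ e e0) /nbhs_ballP[r /= r0 Hr].
  have : (fun h : R => `|h| * (`|u| + `|v|)) @ 0^' --> (0 : R).
    have : (fun h : R => `|h| * (`|u| + `|v|)) @ 0^' --> `|0 : R| * (`|u| + `|v|).
      apply: cvgM; last exact: cvg_cst; apply: cvg_norm; exact: nbhs_dnbhs.
    by rewrite normr0 mul0r.
  move=> /cvgrPdist_lt /(_ r r0) Hs.
  near=> h.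
  have h0 : h != 0 by near: h; exact: nbhs_dnbhs_neq.
  have hs : `|h| * (`|u| + `|v|) < r.
    have : `|0 - `|h| * (`|u| + `|v|)| < r by near: h.
    by rewrite sub0r normrN ger0_norm // mulr_ge0 // addr_ge0.
  have dhu z : is_derive z (h *: u) f (h * 'D_u f z).
    by apply: is_derive_scale_dir; exact: derivableP.
  have [|th /andP[th0 th1]] := @mvt_direction f (h *: v + x) (h *: u).
    by move=> z; case: (dhu z).
  rewrite [h *: u + _]addrC => ->.
  rewrite (@derive_val _ _ _ _ _ _ _ (dhu _)) /GRing.scale /= mulKf //.
  apply: Hr; rewrite -ball_normE /=.
  have -> : x - (h *: v + x + th *: (h *: u)) = - (th *: (h *: u) + h *: v).
    by rewrite opprD [h *: v + x]addrC opprD !addrA subrr add0r opprD addrC.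
  rewrite normrN (le_lt_trans _ hs) // (le_trans (ler_normD _ _)) // mulrDr.
  rewrite lerD // !normrZ // (gtr0_norm th0) ler_piMl // ?mulr_ge0 // ltW //.
have -> : (fun h : R => h^-1 *: ((f \o shift x) (h *: (u + v)) - f x)) =
  (fun h : R => h^-1 *: (f (h *: u + (h *: v + x)) - f (h *: v + x)))
  \+ (fun h : R => h^-1 *: ((f \o shift x) (h *: v) - f x)).
  apply/funext => h /=; rewrite -scalerDr; congr (_ *: _).
  by rewrite addrA subrK scalerDr addrA.
exact: cvgD.
Unshelve. all: by end_near.
Qed.

(** If the second derivative were positive, ['D_v f] would vanish at [x] and be
    positive just after it along [v], and [f] would exceed [f x] there. *)
Lemma derive2_at_max f x v : (forall z, derivable f z v) ->
  (forall z, derivable ('D_v f) z v) -> (forall z, f z <= f x) ->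
  'D_v f x = 0 /\ 'D_v ('D_v f) x <= 0.
Proof.
move=> df ddf fmax.
have dg (r : R) : is_derive r (1 : R) (fun h => f (x + h *: v)) ('D_v f (x + r *: v)).
  exact/is_derive_line/derivableP.
have dg' (r : R) : is_derive r (1 : R) (fun h => 'D_v f (x + h *: v))
    ('D_v ('D_v f) (x + r *: v)).
  exact/(@is_derive_line ('D_v f))/derivableP.
have E0 : 'D_v f x = 0.
  have : is_derive (0 : R) (1 : R) (fun h => f (x + h *: v)) 0.
    have I0 : (0 : R) \in `]-1, 1[%R by rewrite in_itv /= ltrN10 ltr01.
    have N11 : (-1 : R) <= 1 by rewrite (le_trans (lerN10 _)).
    apply: (@derive1_at_max _ (fun h : R => f (x + h *: v)) (- 1) 1 0 N11 _ I0).
      by move=> t _; case: (dg t).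
    by move=> t _; rewrite scale0r addr0 fmax.
  by move=> /@derive_val <-; have /@derive_val -> := dg 0; rewrite scale0r addr0.
split=> //; rewrite leNgt; apply/negP => ddpos.
have : h^-1 *: ('D_v f (h *: v + x) - 'D_v f x) @[h --> 0^'] --> 'D_v ('D_v f) x.
  exact: ddf.
move=> /cvgrPdist_lt /(_ _ ddpos) /nbhs_ballP[r /= r0 Hr].
have pos (h : R) : 0 < h < r -> 0 < 'D_v f (x + h *: v).
  move=> /andP[h0 hr].
  have : `|'D_v ('D_v f) x - h^-1 *: ('D_v f (h *: v + x) - 'D_v f x)| < 'D_v ('D_v f) x.
    apply: Hr; last by rewrite gt_eqF.
    by rewrite -ball_normE /= sub0r normrN gtr0_norm.
  rewrite E0 subr0 [h *: v + x]addrC => /ltr_normlP[_]; rewrite ltrBlDr ltrDl.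
  by rewrite /GRing.scale /= pmulr_rgt0 // invr_gt0.
have r2 : 0 < r / 2 by rewrite divr_gt0.
have cg : {within `[0, r / 2], continuous (fun h : R => f (x + h *: v))}.
  apply: continuous_subspaceT => t.
  by apply: differentiable_continuous; apply/derivable1_diffP; case: (dg t).
have [c] := @MVT R _ _ 0 (r / 2) r2 (fun t _ => dg t) cg.
rewrite in_itv /= => /andP[c0 cr] E.
have : 0 < f (x + (r / 2) *: v) - f (x + 0 *: v).
  rewrite E subr0 mulr_gt0 // pos // c0 (lt_trans cr) // ltr_pdivrMr //.
  by rewrite ltr_pMr // ltr1n.
by rewrite scale0r addr0 subr_gt0 ltNge fmax.
Qed.

End DirectionalDerivatives.

(** * Second-order conditions at a maximum *)

Section Hessian.
Context {R : realType} {d : nat}.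
Local Notation Rd := 'rV[R]_d.
Implicit Types (f g : Rd -> R) (x v : Rd).

(** Continuity of the partial derivatives gives access to every direction, by adding
    the coordinates of [v] one at a time.  The classes of functions considered here
    only control derivatives along the canonical basis, while the sign of the
    Hessian must be tested against all vectors. *)
Lemma is_derive_partials f v x : partials_exist f ->
  (forall i, continuous (partial i f)) ->
  is_derive x v f (\sum_i v 0 i * partial i f x).
Proof.
move=> pf cf.
have {1}-> : v = \sum_i v 0 i *: basis_vec i.
  by rewrite [LHS]row_sum_delta.
elim/big_rec2: _ => [|i df u _ IH]; first exact: is_derive0.
have pz z : is_derive z (v 0 i *: basis_vec i) f (v 0 i * partial i f z).
  by apply: is_derive_scale_dir; exact: derivableP.
have E : 'D_(v 0 i *: basis_vec i) f = (fun z => v 0 i * partial i f z).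
  by apply/funext => z; exact: derive_val.
have <- : 'D_(v 0 i *: basis_vec i) f x = v 0 i * partial i f x.
  by have [_ ->] := pz x.
apply: (is_deriveD_dir (fun z => @ex_derive _ _ _ _ _ _ _ (pz z)) _ IH).
rewrite E; apply: continuousM; [exact: cst_continuous|exact: cf].
Qed.

Lemma C2_at_max f x : C2 f -> (forall z, f z <= f x) ->
  gradient f x = 0 /\ forall v, dot (v *m (hessian f x)^T) v <= 0.
Proof.
move=> [cf pf cpf ppf cppf] fmax.
have d1 v z := is_derive_partials v z pf cpf.
have D1 v : 'D_v f = (fun z => \sum_i v 0 i * partial i f z).
  by apply/funext => z; exact: derive_val.
have d2 v z : is_derive z v ('D_v f)
    (\sum_j v 0 j * \sum_i v 0 i * partial i (partial j f) z).
  rewrite D1.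
  have -> : (fun z => \sum_i v 0 i * partial i f z) =
      \sum_i (fun z => v 0 i *: partial i f z).
    by apply/funext => y; rewrite fct_sumE.
  apply: is_derive_sum => i; apply: is_deriveZ.
  exact: (is_derive_partials v z (ppf i) (cppf^~ i)).
have M v := derive2_at_max (fun z => @ex_derive _ _ _ _ _ _ _ (d1 v z))
  (fun z => @ex_derive _ _ _ _ _ _ _ (d2 v z)) fmax.
split.
  by apply/rowP => i; rewrite !mxE; exact: (M (basis_vec i)).1.
move=> v; have [_] := M v; rewrite (@derive_val _ _ _ _ _ _ _ (d2 v x)).
apply: le_trans; rewrite /dot le_eqVlt; apply/orP; left; apply/eqP.
under [RHS]eq_bigr do rewrite mulr_sumr.
rewrite exchange_big /=; apply: eq_bigr => i _.
rewrite mxE mulr_suml; apply: eq_bigr => j _.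
by rewrite !mxE -mulrA; congr (_ * _); rewrite mulrC.
Qed.

Lemma dotE (x y : Rd) : dot x y = (x *m y^T) 0 0.
Proof. by rewrite mxE; apply: eq_bigr => i _; rewrite mxE. Qed.

(** Symmetric Gaussian elimination writes a positive semidefinite [A] as a sum of
    rank-one matrices [v^T v] with positive weights, and
    [\tr (v^T v H) = v H v^T].  The induction is on the number of nonzero rows. *)
Lemma trace_psd_nsd_le0 (A H : 'M[R]_d) : A^T = A ->
  (forall x : Rd, 0 <= (x *m A *m x^T) 0 0) ->
  (forall x : Rd, (x *m H *m x^T) 0 0 <= 0) ->
  \tr (A *m H) <= 0.
Proof.
move=> sA pA nH; have [m] := ubnP #|[pred i | row i A != 0]|.
elim: m A sA pA => // m IH A sA pA ltm.
case: (pickP [pred i | row i A != 0]) => [k /= vN0|A0]; last first.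
  suff -> : A = 0 by rewrite mul0mx mxtrace0.
  apply/row_matrixP => i; rewrite row0; apply/eqP.
  by have /negbFE := A0 i.
set v := row k A; set a := A k k; pose e : Rd := delta_mx 0 k.
have eA : e *m A = v by rewrite -rowE.
have Ae : A *m e^T = v^T by rewrite -eA trmx_mul sA.
have QE (x : Rd) (s : R) : ((x + s *: e) *m A *m (x + s *: e)^T) 0 0 =
    (x *m A *m x^T) 0 0 + 2 * s * (x *m v^T) 0 0 + s ^+ 2 * a.
  rewrite linearD linearZ /= !mulmxDl !mulmxDr -!scalemxAl -!scalemxAr eA.
  rewrite -[x *m A *m e^T]mulmxA Ae.
  have -> : v *m x^T = x *m v^T.
    by apply/matrixP => i j; rewrite !ord1 -!dotE; apply: eq_bigr => l _; rewrite mulrC.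
  have -> : v *m e^T = a%:M.
    apply/matrixP => i j; rewrite !ord1 mxE (bigD1 k) //= big1 ?addr0.
      by rewrite !mxE !eqxx mulr1 mulr1n.
    by move=> l lk; rewrite !mxE (negbTE lk) andbF mulr0.
  rewrite !mxE !eqxx mulr1n.
  set p := \sum_j _; set q := \sum_j _; ring.
have vv : 0 < (v *m v^T) 0 0.
  rewrite lt_def; apply/andP; split; last first.
    by rewrite mxE sumr_ge0 // => i _; rewrite [v^T _ _]mxE -expr2 sqr_ge0.
  apply: contra vN0; rewrite mxE psumr_eq0; last first.
    by move=> i _; rewrite [v^T _ _]mxE -expr2 sqr_ge0.
  move=> /allP vi0; apply/eqP/rowP => i.
  have := vi0 i (mem_index_enum _); rewrite [v^T _ _]mxE -expr2 sqrf_eq0 => /eqP vi.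
  by rewrite -/v vi mxE.
have a0 : 0 < a.
  have := pA e; rewrite eA.
  have -> : (v *m e^T) 0 0 = a.
    rewrite mxE (bigD1 k) //= big1 ?addr0; first by rewrite !mxE !eqxx mulr1.
    by move=> l lk; rewrite !mxE (negbTE lk) andbF mulr0.
  rewrite le_eqVlt => /orP[/eqP a0|//].
  (* If [A k k] vanished, the quadratic form would be affine in [s] along
     [v + s e], with nonzero slope: the chosen [s] makes it equal to [-1]. *)
  set q := (v *m A *m v^T) 0 0; set b := (v *m v^T) 0 0 in vv.
  have := pA (v + (- (q + 1) / (2 * b)) *: e); rewrite QE -a0 mulr0 addr0 -/q -/b.
  have -> : q + 2 * (- (q + 1) / (2 * b)) * b = -1 by field; rewrite gt_eqF.
  by rewrite lerNr oppr0 leNgt ltr01.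
(* The form of [A'] at [x] is that of [A] at [x - (b / a) e], with [b = x v^T]. *)
set A' := A - a^-1 *: (v^T *m v).
have -> : A = A' + a^-1 *: (v^T *m v) by rewrite subrK.
rewrite mulmxDl linearD /= -scalemxAl linearZ /= -mulmxA [\tr (v^T *m _)]mxtrace_mulC trace_mx11.
rewrite -[leRHS]addr0 lerD // ?pmulr_rle0 ?invr_gt0 ?nH //.
apply: IH.
- by rewrite linearB linearZ /= trmx_mul trmxK sA.
- move=> x; rewrite mulmxBr mulmxBl -scalemxAr -scalemxAl mulmxA.
  rewrite -(mulmxA (x *m v^T) v x^T).
  set b := (x *m v^T) 0 0.
  have := pA (x + (- b / a) *: e); rewrite QE -/b.
  have -> : x *m v^T = b%:M by apply/matrixP => i j; rewrite !ord1 [RHS]mxE eqxx.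
  have -> : v *m x^T = b%:M.
    apply/matrixP => i j; rewrite !ord1 [RHS]mxE eqxx /b -!dotE.
    by apply: eq_bigr => l _; rewrite mulrC.
  rewrite -scalar_mxM !mxE eqxx mulr1n; set q := \sum_j _.
  rewrite (_ : q + _ + _ = q - a^-1 * (b * b)) //.
  by field; rewrite gt_eqF.
- rewrite -ltnS; apply: leq_trans ltm; rewrite ltnS; apply: proper_card.
  apply/properP; split; last first.
    exists k; rewrite inE // negbK; apply/eqP/rowP => j.
    by rewrite !mxE big_ord1 !mxE -/a mulrA mulVf ?gt_eqF // mul1r subrr.
  apply/fintype.subsetP => i; rewrite !inE; apply: contra => /eqP /rowP Ai.
  apply/eqP/rowP => j; rewrite !mxE big_ord1 !mxE.
  have := Ai j; rewrite !mxE => ->; have := Ai k; rewrite !mxE.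
  have <- : A^T i k = A k i by rewrite mxE.
  by rewrite sA => ->; rewrite mul0r mulr0 subrr.
Qed.


(** The drift term vanishes with the gradient, and the second-order term is the
    trace of the product of a positive and a negative semidefinite matrix. *)
Lemma opA_at_max_le0 (Q : R -> 'M[R]_d) (b : R -> Rd -> Rd) (t : R) f x :
  (Q t)^T = Q t -> (forall xi : Rd, 0 <= dot (xi *m (Q t)^T) xi) ->
  C2 f -> (forall z, f z <= f x) -> opA Q b t f x <= 0.
Proof.
move=> sQ pQ f2 fmax; have [g0 nH] := C2_at_max f2 fmax.
rewrite /opA g0 [X in _ + X](_ : _ = 0) ?addr0; last first.
  by rewrite /dot big1 // => i _; rewrite mxE mulr0.
apply: trace_psd_nsd_le0 => // v.
  by rewrite -[X in _ *m X *m _]sQ -dotE.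
have := nH v; rewrite dotE; apply: le_trans.
have -> : (v *m hessian f x *m v^T) 0 0 = ((v *m hessian f x *m v^T)^T) 0 0.
  by rewrite [RHS]mxE.
by rewrite !trmx_mul trmxK mulmxA.
Qed.

End Hessian.

(** * Linearity of the differential operator *)

Section Linearity.
Context {R : realType} {d : nat}.
Local Notation Rd := 'rV[R]_d.
Implicit Types (f g : Rd -> R) (x v : Rd) (k : R).

Lemma is_derive_lincomb f g k x v df dg : is_derive x v f df -> is_derive x v g dg ->
  is_derive x v (fun y => f y + k * g y) (df + k * dg).
Proof.
move=> Hf Hg; have := @is_deriveD _ _ _ _ _ _ _ _ _ Hf (@is_deriveZ _ _ _ g k _ _ _ Hg).
by [].
Qed.

Lemma partial_lincomb f g k i : partials_exist f -> partials_exist g ->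
  partial i (fun y => f y + k * g y) = (fun y => partial i f y + k * partial i g y).
Proof.
move=> pf pg; apply/funext => y.
exact: (@derive_val _ _ _ _ _ _ _
  (is_derive_lincomb k (derivableP (pf i y)) (derivableP (pg i y)))).
Qed.

Lemma partials_exist_lincomb f g k : partials_exist f -> partials_exist g ->
  partials_exist (fun y => f y + k * g y).
Proof.
move=> pf pg i y.
by have [] := is_derive_lincomb k (derivableP (pf i y)) (derivableP (pg i y)).
Qed.

Lemma continuous_lincomb f g k : continuous f -> continuous g ->
  continuous (fun y => f y + k * g y).
Proof.
move=> cf cg y; apply: (@continuousD _ _ _ f (fun y => k * g y)); first exact: cf.
by apply: (@continuousM _ _ (fun=> k) g); [exact: cst_continuous|exact: cg].
Qed.

Lemma C2_lincomb f g k : C2 f -> C2 g -> C2 (fun y => f y + k * g y).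
Proof.
move=> [cf pf cpf ppf cppf] [cg pg cpg ppg cppg]; split.
- exact: continuous_lincomb.
- exact: partials_exist_lincomb.
- by move=> i; rewrite (partial_lincomb k i pf pg); apply: continuous_lincomb; [exact: cpf|exact: cpg].
- by move=> i; rewrite (partial_lincomb k i pf pg); exact: (@partials_exist_lincomb _ _ k (ppf i) (ppg i)).
- move=> i j; rewrite (partial_lincomb k j pf pg) (partial_lincomb k i (ppf j) (ppg j)).
  by apply: continuous_lincomb; [exact: cppf|exact: cppg].
Qed.

Lemma partial_cst (c : R) (i : 'I_d) : partial i (fun=> c) = fun=> 0.
Proof. by apply/funext => y; exact: derive_cst. Qed.

Lemma C2_cst (c : R) : C2 (fun _ : Rd => c).
Proof.
split.
- exact: cst_continuous.
- by move=> i y; exact: derivable_cst.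
- by move=> i; rewrite partial_cst; exact: cst_continuous.
- by move=> i j y; rewrite partial_cst; exact: derivable_cst.
- by move=> i j; rewrite !partial_cst; exact: cst_continuous.
Qed.

Lemma opA_cst (Q : R -> 'M[R]_d) (b : R -> Rd -> Rd) t c x :
  opA Q b t (fun=> c) x = 0.
Proof.
rewrite /opA.
have -> : hessian (fun _ : Rd => c) x = 0.
  by apply/matrixP => i j; rewrite !mxE !partial_cst.
rewrite mulmx0 mxtrace0 add0r /dot big1 // => i _.
by rewrite mxE partial_cst mulr0.
Qed.

Lemma opA_lincomb (Q : R -> 'M[R]_d) (b : R -> Rd -> Rd) t f g k x : C2 f -> C2 g ->
  opA Q b t (fun y => f y + k * g y) x = opA Q b t f x + k * opA Q b t g x.
Proof.
move=> [cf pf cpf ppf cppf] [cg pg cpg ppg cppg]; rewrite /opA.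
have -> : hessian (fun y => f y + k * g y) x = hessian f x + k *: hessian g x.
  apply/matrixP => i j; rewrite !mxE (partial_lincomb k j pf pg).
  by rewrite (partial_lincomb k i (ppf j) (ppg j)).
rewrite mulmxDr -scalemxAr linearD linearZ /= mulrDr addrACA; congr (_ + _).
rewrite /dot mulr_sumr -big_split; apply: eq_bigr => i _.
by rewrite !mxE (partial_lincomb k i pf pg) mulrDr mulrCA.
Qed.

End Linearity.

(** * The parabolic maximum principle *)

Section MaximumPrinciple.
Context {R : realType}.

(** The maximum over a time interval may sit at its right end, where only the left
    difference quotients have a sign. *)
Lemma ge0_derive_left_max (g : R -> R) (s t dg : R) : s < t ->
  is_derive t (1 : R) g dg -> (forall r, s <= r <= t -> g r <= g t) -> 0 <= dg.
Proof.
move=> st [dgt dgE] gmax; rewrite leNgt; apply/negP => dg0.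
have Hc : h^-1 *: ((g \o shift t) (h *: (1 : R)) - g t) @[h --> 0^'] --> dg.
  by rewrite -dgE; exact: dgt.
have e0 : 0 < - dg by rewrite oppr_gt0.
move/cvgrPdist_lt: Hc => /(_ _ e0) /nbhs_ballP[r /= r0 Hr].
pose h : R := - (Num.min (t - s) (r / 2)).
have m0 : 0 < Num.min (t - s) (r / 2) by rewrite lt_min subr_gt0 st divr_gt0.
have hr : `|h| < r.
  rewrite normrN gtr0_norm // gt_min; apply/orP; right.
  by rewrite ltr_pdivrMr // ltr_pMr // ltr1n.
have hN0 : h != 0 by rewrite oppr_eq0 gt_eqF.
have : `|dg - h^-1 *: ((g \o shift t) (h *: (1 : R)) - g t)| < - dg.
  by apply: Hr => //; rewrite -ball_normE /= sub0r normrN.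
move=> /ltr_normlP[+ _]; rewrite opprB ltrBlDr addNr /=.
rewrite [h *: 1]mulr1 /GRing.scale /=.
have h0 : h < 0 by rewrite oppr_lt0.
rewrite nmulr_rlt0 ?invr_lt0 // subr_gt0 => /lt_le_trans.
have ht : s <= h + t <= t.
  have : Num.min (t - s) (r / 2) <= t - s by rewrite ge_min lexx.
  by move: h0; rewrite /h => h0 ms; apply/andP; split; lra.
by move=> /(_ _ (gmax _ ht)); rewrite ltxx.
Qed.

Lemma norm_le_enorm d (x : 'rV[R]_d) : `|x| <= enorm x.
Proof.
rewrite [leLHS]mx_normrE; apply: bigmax_le => [|[i j] _]; first exact: sqrtr_ge0.
rewrite /= !ord1 -sqrtr_sqr /enorm ler_sqrt.
  rewrite /dot (bigD1 j) //= -expr2 lerDl sumr_ge0 // => k _.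
  by rewrite -expr2 sqr_ge0.
by rewrite sumr_ge0 // => k _; rewrite -expr2 sqr_ge0.
Qed.

Context {d : nat}.
Local Notation Rd := 'rV[R]_d.

(** Subtracting [eps * psi] with [psi = phi + (a + 1) (t - s)], for which
    [D_t psi - A psi >= 1], makes the supremum a maximum, because [phi] is coercive
    and [z] is bounded above.  At a positive maximum the two sides of the
    differential inequality have incompatible signs. *)
Theorem maximum_principle (i0 alpha : R) (Q : R -> 'M[R]_d) (b : R -> Rd -> Rd)
    (s M : R) (z : R -> Rd -> R) :
  standing_assumptions i0 alpha Q b -> i0 < s ->
  {within [set y : R * Rd | s <= y.1], continuous (fun y : R * Rd => z y.1 y.2)} ->
  (forall t x, s <= t -> z t x <= M) ->
  (forall t x, s < t -> derivable (fun r => z r x) t 1) ->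
  (forall t, s < t -> C2 (z t)) ->
  (forall t x, s < t -> 0 < z t x -> time_deriv z t x <= opA Q b t (z t) x) ->
  (forall x, z s x <= 0) ->
  forall t x, s <= t -> z t x <= 0.
Proof.
move=> hA i0s cz zM dz z2 zsub zs t0 x0 st0; rewrite leNgt; apply/negP => zpos.
have [phi [phi2 phi0 phiy [a [gam [a0 gam0 Lphi]]]]] := sa_lyapunov hA.
(* Any slope larger than [a] makes [psi] a strict supersolution. *)
pose psi (t : R) x := phi x + (a + 1) * (t - s).
have a10 : 0 < a + 1 by rewrite addr_gt0.
have psi0 t x : s <= t -> 0 < psi t x.
  by move=> st; rewrite ltr_wpDr // mulr_ge0 ?subr_ge0 // ltW.
have [eps eps0 Heps] : exists2 eps : R, 0 < eps & eps * psi t0 x0 < z t0 x0.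
  exists (z t0 x0 / (2 * psi t0 x0)).
    by rewrite divr_gt0 // mulr_gt0 // psi0.
  rewrite invfM mulrA mulfVK ?gt_eqF ?psi0 // ltr_pdivrMr // ltr_pMr //.
  by rewrite ltr1n.
pose y (t : R) x := z t x - eps * psi t x.
have y0 : 0 < y t0 x0 by rewrite subr_gt0.
have [rho Hrho] := phiy (M / eps).
(* Outside the ball of radius [r] the function [y] is negative, so its maximum over
   the compact cylinder is a maximum over the whole strip. *)
pose r := Num.max rho `|x0|.
have yout t x : s <= t -> r < `|x| -> y t x < 0.
  move=> st; rewrite gt_max => /andP[rx _].
  have := Hrho x (lt_le_trans rx (norm_le_enorm x)).
  rewrite ltr_pdivrMr // mulrC => Hx.
  rewrite subr_lt0 (le_lt_trans (zM _ _ st)) // (lt_le_trans Hx) //.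
  by rewrite ler_pM2l // lerDl mulr_ge0 ?subr_ge0 // ltW.
pose K := `[s, t0] `*` [set x : Rd | `|x| <= r].
have cK : compact K.
  apply: compact_setX; first exact: segment_compact.
  apply: bounded_closed_compact.
    exists r; split => [|r' rr' x /= xr]; first exact: num_real.
    by rewrite (le_trans xr) // ltW.
  have -> : [set x : Rd | `|x| <= r] = (fun x : Rd => `|x|) @^-1` [set u | u <= r] by [].
  by apply: preimage_closed; [move=> ? _; exact: norm_continuous|exact: closed_le].
have K0 : K (t0, x0).
  by split => /=; rewrite ?in_itv /= ?st0 ?lexx // le_max lexx orbT.
have cphi : continuous phi by case: phi2.
have cpsi : continuous (fun p : R * Rd => psi p.1 p.2).
  move=> p; apply: (@continuousD _ _ _ (fun p : R * Rd => phi p.2)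
     (fun p : R * Rd => (a + 1) * (p.1 - s))).
    apply: (@continuous_comp _ _ _ snd phi); [exact: cvg_snd|exact: cphi].
  apply: (@continuousM _ _ (fun=> a + 1) (fun p : R * Rd => p.1 - s)).
    exact: cst_continuous.
  apply: (@continuousB _ _ _ (fun p : R * Rd => p.1) (fun=> s)).
    exact: cvg_fst.
  exact: cst_continuous.
have KS : K `<=` [set p : R * Rd | s <= p.1].
  by move=> [t x] [/=]; rewrite in_itv /= => /andP[].
have cy : {within K, continuous (fun p : R * Rd => y p.1 p.2)}.
  have cz' := continuous_subspaceW KS cz.
  have cpsi' : {within K, continuous (fun p : R * Rd => psi p.1 p.2)}.
    by apply: continuous_subspaceT; exact: cpsi.
  move=> p; apply: cvgB; first exact: cz'.
  apply: cvgM; first exact: cvg_cst.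
  exact: cpsi'.
have [[t1 x1] /set_mem K1 ymax] := compact_EVT_max (ex_intro _ _ K0) cK cy.
have y1 : 0 < y t1 x1.
  by apply: lt_le_trans y0 _; have := ymax (t0, x0); apply; exact/mem_set.
have /andP[st1 t10] : s <= t1 <= t0 by case: K1 => /=; rewrite in_itv.
have gmax t x : s <= t <= t0 -> y t x <= y t1 x1.
  move=> /andP[st tt0]; have [xr|xr] := leP `|x| r; last first.
    by rewrite (le_trans (ltW (yout _ _ st xr))) // ltW.
  have := ymax (t, x); apply; apply/mem_set; split => //=.
  by rewrite in_itv /= st tt0.
have {}st1 : s < t1.
  rewrite lt_neqAle st1 andbT; apply/eqP => E; move: y1; rewrite -E.
  rewrite ltNge /y => /negP; apply; rewrite subr_le0 (le_trans (zs _)) //.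
  by rewrite mulr_ge0 // ltW // psi0.
have z1 : 0 < z t1 x1.
  by apply: lt_le_trans y1 _; rewrite lerBlDr lerDl mulr_ge0 // ltW // psi0 // ltW.
have it1 : i0 < t1 by exact: lt_trans st1.
have C2y' : C2 (fun x => z t1 x + (- eps) * phi x) by exact: (C2_lincomb (- eps) (z2 t1 st1) phi2).
pose k := - eps * ((a + 1) * (t1 - s)).
have yE : y t1 = fun x => (z t1 x + (- eps) * phi x) + k * 1.
  by apply/funext => x; rewrite /y /psi /k; ring.
have Ay : opA Q b t1 (y t1) x1 <= 0.
  have [e0 [La [/andP[e00 _] Hell]]] := sa_elliptic hA.
  apply: opA_at_max_le0.
  - exact: (sa_Q_sym hA).
  - move=> xi; have /andP[+ _] := Hell t1 xi it1; apply: le_trans.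
    by rewrite mulr_ge0 ?sqr_ge0 // ltW.
  - by rewrite yE; exact: (C2_lincomb k C2y' (C2_cst 1)).
  - by move=> x; apply: gmax; rewrite ltW.
have AyE : opA Q b t1 (y t1) x1 = opA Q b t1 (z t1) x1 - eps * opA Q b t1 phi x1.
  rewrite yE (opA_lincomb Q b t1 k x1 C2y' (C2_cst 1)) opA_cst mulr0 addr0.
  by rewrite (opA_lincomb Q b t1 (- eps) x1 (z2 t1 st1) phi2) mulNr.
have dy : is_derive t1 (1 : R) (fun t => y t x1) (time_deriv z t1 x1 - eps * (a + 1)).
  have dz1 : is_derive t1 (1 : R) (fun t => z t x1) (time_deriv z t1 x1).
    by rewrite /time_deriv derive1E; apply: derivableP; exact: dz.
  have dpsi : is_derive t1 (1 : R) (fun t => eps * psi t x1) (eps * (a + 1)).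
    rewrite /psi; apply: is_derive_eq.
    by rewrite /GRing.scale /=; ring.
  exact: is_deriveB.
have D : 0 <= time_deriv z t1 x1 - eps * (a + 1).
  apply: (ge0_derive_left_max st1 dy) => t /andP[st tt1]; apply: gmax.
  by rewrite st (le_trans tt1).
have Dz := zsub t1 x1 st1 z1.
have Aphi : eps * opA Q b t1 phi x1 <= eps * a.
  by rewrite ler_pM2l // (le_trans (Lphi _ _ it1)) // gerBl mulr_ge0 // ltW.
by rewrite AyE in Ay; lra.
Qed.

End MaximumPrinciple.

(** * Regularity of classical solutions *)

Section Regularity.
Context {R : realType} {d : nat}.
Local Notation Rd := 'rV[R]_d.

Lemma coord_le_norm (x : Rd) i : `|x 0 i| <= `|x|.
Proof. by rewrite [leRHS]mx_normrE; apply: (le_bigmax _ _ (0, i)). Qed.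

Lemma enorm_le_norm (x : Rd) : enorm x <= Num.sqrt d%:R * `|x|.
Proof.
rewrite -[X in _ * X]normr_id -[X in _ * X]sqrtr_sqr -sqrtrM // ler_sqrt; last first.
  by rewrite mulr_ge0 ?sqr_ge0.
have -> : d%:R * `|x| ^+ 2 = \sum_(i < d) `|x| ^+ 2.
  by rewrite sumr_const card_ord mulr_natl.
apply: ler_sum => i _; rewrite -expr2 -real_normK ?num_real //.
by rewrite lerXn2r ?nnegrE // coord_le_norm.
Qed.

(** On a compact set contained in the slice of time [t], the time increment of the
    parabolic Hoelder modulus is zero. *)
Lemma parabolic_holder_continuous (s alpha : R) (u : R -> Rd -> R) t :
  0 < alpha -> parabolic_holder_loc s alpha u -> s < t -> continuous (u t).
Proof.
move=> al0 hu st; suff: forall x : Rd, u t y @[y --> x] --> u t x by [].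
move=> x; have FF : Filter (nbhs x) by exact: (@nbhs_filter Rd x).
pose K : set (R * Rd) := [set t] `*` [set y : Rd | `|x - y| <= 1].
have cd : continuous (fun y : Rd => `|x - y|).
  move=> y; apply: (@continuous_comp Rd Rd R (fun y : Rd => x - y) (fun v : Rd => `|v|)).
    by apply: (@continuousB _ _ _ (fun=> x) id); [exact: cst_continuous|exact: cvg_id].
  exact: norm_continuous.
have cK : compact K.
  apply: compact_setX; first exact: compact_set1.
  apply: bounded_closed_compact.
    exists (`|x| + 1); split => [|r' rr' y /= xy]; first exact: num_real.
    rewrite (le_trans _ (ltW rr')) // -[y](subKr x).
    by rewrite (le_trans (ler_normB _ _)) // lerD.
  have -> : [set y : Rd | `|x - y| <= 1] = (fun y : Rd => `|x - y|) @^-1` [set u | u <= 1].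
    by [].
  apply: preimage_closed; last exact: closed_le.
  by move=> y _; exact: cd.
have Ks : K `<=` [set z | s < z.1] by move=> [t' y] [/= -> _].
have [M HM] := hu K cK Ks.
apply/cvgrPdist_lt => e e0.
have m0 : 0 < `|M| + 1 by rewrite ltr_wpDl.
have em0 : 0 < e / (`|M| + 1) by rewrite divr_gt0.
have [r /= r0 Hr] := (cvgrPdist_lt _ _).1 (powR_cvg0 al0) _ em0.
have small a : 0 <= a < r -> a `^ alpha < e / (`|M| + 1).
  move=> /andP[]; rewrite le_eqVlt => /orP[/eqP <- _|a0 ar].
    by rewrite powR0 // gt_eqF.
  have := Hr a; rewrite /= sub0r normrN gtr0_norm // => /(_ ar a0).
  by rewrite sub0r normrN ger0_norm // powR_ge0.
have sd0 : 0 < Num.sqrt (d%:R : R) + 1 by rewrite ltr_wpDl ?sqrtr_ge0.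
near=> y.
have xy1 : `|x - y| < 1 by near: y; exact: cvgr_dist_lt.
have xyr : `|x - y| < r / (Num.sqrt d%:R + 1).
  by near: y; apply: cvgr_dist_lt => //; rewrite divr_gt0.
have Kx : K (t, x) by split => //=; rewrite subrr normr0.
have Ky : K (t, y) by split => //=; rewrite ltW.
have := HM _ _ Kx Ky; rewrite /= subrr normr0 powR0 ?gt_eqF ?divr_gt0 // add0r.
move=> /le_lt_trans; apply.
have : enorm (x - y) `^ alpha < e / (`|M| + 1).
  apply: small; rewrite sqrtr_ge0 /= (le_lt_trans (enorm_le_norm _)) //.
  move: xyr; rewrite ltr_pdivlMr //; apply: le_lt_trans.
  by rewrite mulrC ler_wpM2l // lerDl.
rewrite ltr_pdivlMr // => H; apply: le_lt_trans H.
rewrite mulrC ler_wpM2l ?powR_ge0 // (le_trans (ler_norm _)) // lerDl //.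
Unshelve. all: by end_near.
Qed.

Lemma classical_solution_C2 (s alpha : R) L f (u : R -> Rd -> R) t :
  0 < alpha -> classical_solution alpha L s f u -> s < t -> C2 (u t).
Proof.
move=> al0 [_ [h0 _ h1 h2] _ _] st; split.
- exact: parabolic_holder_continuous h0 st.
- by move=> i; have [p _] := h1 i; exact: p.
- by move=> i; have [_ p] := h1 i; exact: parabolic_holder_continuous p st.
- by move=> i; have [p _] := h2 i i; exact: p.
- by move=> i j; have [_ p] := h2 i j; exact: parabolic_holder_continuous p st.
Qed.

Lemma classical_solution_is_derive (s alpha : R) L f (u : R -> Rd -> R) t x :
  classical_solution alpha L s f u -> s < t ->
  is_derive t (1 : R) (fun r => u r x) (L t (u t) x).
Proof.
move=> [_ [_ [du _] _ _] eqn _] st.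
by rewrite -eqn // /time_deriv derive1E; apply: derivableP; exact: du.
Qed.

Lemma classical_solution_slice_continuous (s alpha : R) L f (u : R -> Rd -> R) t :
  0 < alpha -> classical_solution alpha L s f u -> s < t -> continuous (u t).
Proof. by move=> al0 hu st; have [] := classical_solution_C2 al0 hu st. Qed.

Lemma Cb_dist (f g : Rd -> R) : Cb f -> Cb g -> Cb (fun x => `|f x - g x|).
Proof.
move=> [cf [Mf Hf]] [cg [Mg Hg]]; split.
  move=> x; apply: (@continuous_comp _ _ _ (fun y => f y - g y) (fun r : R => `|r|)).
    by apply: (@continuousB _ _ _ f g); [exact: cf|exact: cg].
  exact: norm_continuous.
by exists (Mf + Mg) => x; rewrite normr_id (le_trans (ler_normB _ _)) // lerD.
Qed.

Lemma Cb_cst (k : R) : Cb (fun _ : Rd => k).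
Proof. by split; [exact: cst_continuous|exists `|k|]. Qed.

End Regularity.

(** * Comparison of the two evolution operators *)

Section Comparison.
Context {R : realType} {d : nat}.
Local Notation Rd := 'rV[R]_d.
Variables (i0 alpha : R) (Q : R -> 'M[R]_d) (b : R -> Rd -> Rd).
Hypothesis hA : standing_assumptions i0 alpha Q b.
Variable G : R -> R -> (Rd -> R) -> Rd -> R.
Hypothesis hG : is_evolution_G i0 alpha Q b G.

Let alpha_gt0 : 0 < alpha. Proof. by have /andP[] := sa_alpha hA. Qed.

Lemma evolution_ge0 s t f x : i0 < s -> s <= t -> Cb f -> (forall y, 0 <= f y) ->
  0 <= G t s f x.
Proof.
move=> i0s st Cf f0; have [solu [M HM]] := hG i0s Cf.
have [cu _ _ u0] := solu.
rewrite -oppr_le0; move: t x st.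
apply: (@maximum_principle _ _ _ _ _ _ s M (fun t x => - G t s f x) hA i0s).
- by move=> y; apply: cvgN; exact: cu.
- by move=> t x st; have := HM t x st; rewrite -normrN; exact/le_trans/ler_norm.
- move=> t x st; apply: derivableN.
  by have [] := classical_solution_is_derive x solu st.
- move=> t st.
  have -> : (fun x => - G t s f x) = (fun x => 0 + (-1) * G t s f x).
    by apply/funext => x; rewrite add0r mulN1r.
  by apply: C2_lincomb; [exact: C2_cst|exact: classical_solution_C2 solu st].
- move=> t x st _.
  have -> : (fun x => - G t s f x) = (fun x => 0 + (-1) * G t s f x).
    by apply/funext => y; rewrite add0r mulN1r.
  rewrite opA_lincomb; [|exact: C2_cst|exact: classical_solution_C2 solu st].
  rewrite opA_cst add0r mulN1r /time_deriv derive1E.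
  by have [_ ->] := is_deriveN (classical_solution_is_derive x solu st).
- by move=> x; rewrite u0 oppr_le0.
Qed.

Lemma evolution_0 s t x : i0 < s -> s <= t -> G t s (fun=> 0) x = 0.
Proof.
move=> i0s st; apply/eqP; rewrite eq_le; apply/andP; split; last first.
  by apply: evolution_ge0 => //; exact: Cb_cst.
have [solu [M HM]] := hG i0s (Cb_cst 0); have [cu _ eqn u0] := solu.
move: t x st; apply: (@maximum_principle _ _ _ _ _ _ s M (fun t => G t s (fun=> 0)) hA i0s).
- exact: cu.
- by move=> t x st; have := HM t x st; exact/le_trans/ler_norm.
- by move=> t x st; have [] := classical_solution_is_derive x solu st.
- by move=> t st; exact: classical_solution_C2 solu st.
- by move=> t x st _; rewrite eqn.
- by move=> x; rewrite u0.
Qed.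

Variables (c : R -> Rd -> R) (c0 : R).
Hypothesis hc0 : forall t x, i0 < t -> c0 <= c t x.
Variable Gc : R -> R -> (Rd -> R) -> Rd -> R.
Hypothesis hGc : is_evolution_Gc i0 alpha Q b c c0 Gc.

Lemma evolution_c_bound s f : i0 < s -> Cb f ->
  exists M : R, forall t x, s <= t -> `|Gc t s f x| <= expR (- c0 * (t - s)) * M.
Proof.
move=> i0s Cf; have [_ Hb] := hGc i0s Cf; have [_ [M HM]] := Cf.
exists M => t x st; rewrite -lee_fin EFinM.
have : ((`|Gc t s f x|)%:E <= sup_norm (Gc t s f))%E.
  by apply: ereal_sup_ubound; exists x.
move=> /le_trans; apply; apply: (le_trans (Hb t st)).
rewrite lee_pmul2l ?lte_fin ?expR_gt0 //; apply: ge_ereal_sup => _ [y _ <-].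
by rewrite lee_fin.
Qed.

(** The function [e^{c0 (t - s)} (u1 - u2) - v], with [u1], [u2], [v] the solutions
    issued from [f1], [f2] and [|f1 - f2|], is a subsolution wherever it is
    positive: there [u1 - u2 > 0], since [v >= 0], and so
    [(c0 - c) (u1 - u2) <= 0]. *)
Lemma evolution_comparison_half s t f1 f2 x : i0 < s -> s <= t -> Cb f1 -> Cb f2 ->
  expR (c0 * (t - s)) * (Gc t s f1 x - Gc t s f2 x)
    <= G t s (fun y => `|f1 y - f2 y|) x.
Proof.
move=> i0s st C1 Cf2; have C12 := Cb_dist C1 Cf2.
have [sol1 _] := hGc i0s C1; have [sol2 _] := hGc i0s Cf2.
have [solv [Mv HMv]] := hG i0s C12.
have [M1 H1] := evolution_c_bound i0s C1; have [M2 H2] := evolution_c_bound i0s Cf2.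
set u1 := fun t => Gc t s f1; set u2 := fun t => Gc t s f2.
set v := fun t => G t s (fun y => `|f1 y - f2 y|).
pose E (t : R) := expR (c0 * (t - s)).
have E0 r : 0 < E r by exact: expR_gt0.
have EN r : E r * expR (- c0 * (r - s)) = 1.
  by rewrite mulNr expRN mulfV // gt_eqF // expR_gt0.
pose z (t : R) (y : Rd) := E t * (u1 t y - u2 t y) - v t y.
rewrite -subr_le0 -[leLHS]/(z t x).
have zE r : z r = fun y => (0 + E r * (u1 r y + (-1) * u2 r y)) + (-1) * v r y.
  by apply/funext => y; rewrite /z; ring.
have [cu1 _ _ u10] := sol1; have [cu2 _ _ u20] := sol2; have [cv _ _ v0] := solv.
have dz r y : s < r -> is_derive r (1 : R) (fun r => z r y)
    (E r * (opAc Q b c r (u1 r) y - opAc Q b c r (u2 r) y)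
     + (u1 r y - u2 r y) * (c0 * E r) - opA Q b r (v r) y).
  move=> sr.
  have D1 := classical_solution_is_derive y sol1 sr.
  have D2 := classical_solution_is_derive y sol2 sr.
  have Dv := classical_solution_is_derive y solv sr.
  have DE : is_derive r (1 : R) E (c0 * E r).
    rewrite /E; apply: is_derive_eq.
    by rewrite /GRing.scale /=; ring.
  by have := is_deriveB (is_deriveM DE (is_deriveB D1 D2)) Dv.
have C2u1 r : s < r -> C2 (u1 r) by exact: classical_solution_C2 sol1.
have C2u2 r : s < r -> C2 (u2 r) by exact: classical_solution_C2 sol2.
have C2v r : s < r -> C2 (v r) by exact: classical_solution_C2 solv.
have C2u r : s < r -> C2 (fun y => u1 r y + (-1) * u2 r y).
  by move=> sr; apply: C2_lincomb; [exact: C2u1|exact: C2u2].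
have C2Eu r : s < r -> C2 (fun y => 0 + E r * (u1 r y + (-1) * u2 r y)).
  by move=> sr; apply: C2_lincomb; [exact: C2_cst|exact: C2u].
move: t x st; apply: (@maximum_principle _ _ _ _ _ _ s (M1 + M2 + Mv) z hA i0s).
- move=> p; apply: cvgB; last exact: cv.
  have cE : {within [set y : R * Rd | s <= y.1], continuous (fun y : R * Rd => E y.1)}.
    apply: continuous_subspaceT => q.
    apply: (@continuous_comp _ _ _ (fun q : R * Rd => c0 * (q.1 - s)) expR).
      apply: (@continuousM _ _ (fun=> c0) (fun p : R * Rd => p.1 - s)).
        exact: cst_continuous.
      apply: (@continuousB _ _ _ (fun p : R * Rd => p.1) (fun=> s)).
        exact: cvg_fst.
      exact: cst_continuous.
    exact: continuous_expR.
  by apply: cvgM; [exact: cE|apply: cvgB; [exact: cu1|exact: cu2]].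
- move=> t x st; rewrite /z.
  have A1 := H1 t x st; have A2 := H2 t x st; have Av := HMv t x st.
  have B1 : E t * u1 t x <= M1.
    rewrite (le_trans (_ : _ <= E t * (expR (- c0 * (t - s)) * M1))) //.
      by rewrite ler_pM2l // (le_trans (ler_norm _)).
    by rewrite mulrA EN mul1r.
  have B2 : E t * - u2 t x <= M2.
    rewrite (le_trans (_ : _ <= E t * (expR (- c0 * (t - s)) * M2))) //.
      by rewrite ler_pM2l // (le_trans (ler_norm _)) // normrN.
    by rewrite mulrA EN mul1r.
  have Bv : - v t x <= Mv by rewrite (le_trans (ler_norm _)) // normrN.
  by rewrite mulrDr !lerD.
- by move=> t x st; have [] := dz t x st.
- by move=> t st; rewrite zE; apply: C2_lincomb; [exact: C2Eu|exact: C2v].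
- move=> t x st zpos.
  have it : i0 < t by exact: lt_trans st.
  rewrite /time_deriv derive1E (@derive_val _ _ _ _ _ _ _ (dz t x st)).
  rewrite zE opA_lincomb; [|exact: C2Eu|exact: C2v].
  rewrite opA_lincomb; [|exact: C2_cst|exact: C2u].
  rewrite opA_lincomb; [|exact: C2u1|exact: C2u2].
  rewrite opA_cst /opAc.
  have v_ge0 : 0 <= v t x by apply: evolution_ge0 => //; exact: ltW.
  have wpos : 0 < u1 t x - u2 t x.
    by rewrite -(pmulr_rgt0 _ (E0 t)); move: zpos; rewrite /z; lra.
  have Ec : 0 <= E t * (u1 t x - u2 t x) * (c t x - c0).
    by rewrite mulr_ge0 ?subr_ge0 ?hc0 // ltW // mulr_gt0.
  by rewrite -subr_ge0 (le_trans Ec) // le_eqVlt; apply/orP; left; apply/eqP; ring.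
- move=> x; rewrite /z /u1 /u2 /v u10 u20 v0 /E subrr mulr0 expR0 mul1r.
  by rewrite subr_le0 ler_norm.
Qed.

Theorem evolution_comparison s t f1 f2 x : i0 < s -> s <= t -> Cb f1 -> Cb f2 ->
  `|Gc t s f1 x - Gc t s f2 x|
    <= expR (- c0 * (t - s)) * G t s (fun y => `|f1 y - f2 y|) x.
Proof.
move=> i0s st C1 Cf2.
rewrite mulNr expRN mulrC ler_pdivlMr ?expR_gt0 // mulrC.
rewrite -[X in X * _](gtr0_norm (expR_gt0 _)) -normrM ler_norml.
rewrite evolution_comparison_half // andbT lerNl -mulrN opprB.
have -> : (fun y => `|f1 y - f2 y|) = (fun y => `|f2 y - f1 y|).
  by apply/funext => y; rewrite distrC.
exact: evolution_comparison_half.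
Qed.

Lemma evolution_c_0 s t x : i0 < s -> s <= t -> Gc t s (fun=> 0) x = 0.
Proof.
move=> i0s st; have [_ Hb] := hGc i0s (Cb_cst 0).
have sup0 : (sup_norm (fun _ : Rd => 0%R : R) <= 0)%E.
  by apply: ge_ereal_sup => _ [y _ <-]; rewrite normr0.
have : ((`|Gc t s (fun=> 0%R) x|)%:E <= 0)%E.
  apply: (@le_trans _ _ (sup_norm (Gc t s (fun=> 0%R)))).
    by apply: ereal_sup_ubound; exists x.
  apply: (le_trans (Hb t st)).
  by rewrite pmule_rle0 ?lte_fin ?expR_gt0.
by rewrite lee_fin normr_le0 => /eqP.
Qed.

End Comparison.

(** * Norms and completeness of Lebesgue spaces *)

(** The real power is differentiable away from [0] only; at [0] the bound
    [a < e^(1/p)] gives [a^p < e]. *)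
Lemma cvg_powR_nneg {R : realType} (p : R) (a : nat -> R) (l : R) : 0 < p ->
  (forall k, 0 <= a k) -> a k @[k --> \oo] --> l -> a k `^ p @[k --> \oo] --> l `^ p.
Proof.
move=> p0 a0 al.
have l0 : 0 <= l by rewrite -(cvg_lim _ al) //; apply: limr_ge; [apply/cvg_ex; exists l|exact: nearW].
move: l0; rewrite le_eqVlt => /orP[/eqP l0|l0]; last first.
  have cl : {for l, continuous (fun x : R => x `^ p)}.
    apply: differentiable_continuous; apply/derivable1_diffP; apply: derivable_powR.
    by rewrite in_itv /= l0.
  exact: (cvg_comp _ _ al cl).
move: al; rewrite -l0 powR0 ?gt_eqF // => al.
apply/cvgrPdist_lt => e e0.
have e10 : 0 < e `^ p^-1 by rewrite powR_gt0.
near=> k; rewrite sub0r normrN ger0_norm ?powR_ge0 //.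
have -> : e = (e `^ p^-1) `^ p by rewrite -powRrM mulVf ?gt_eqF // powRr1 // ltW.
apply: gt0_ltr_powR => //; rewrite ?nnegrE ?a0 ?powR_ge0 //.
rewrite -[ltLHS]ger0_norm // -normrN -sub0r.
by near: k; exact: (cvgrPdist_lt _ _).1 al _ e10.
Unshelve. all: by end_near.
Qed.

Lemma ge0_cvge0P {R : realType} (a : nat -> \bar R) : (forall n, (0 <= a n)%E) ->
  a @ \oo --> 0%E <->
  forall e : R, 0 < e -> \forall n \near \oo, (a n <= e%:E)%E.
Proof.
move=> a0; split=> [/fine_cvgP[afin /cvgrPdist_le ac] e e0|ae].
  near=> n; have an : a n \is a fin_num by near: n.
  rewrite -(fineK an) lee_fin -[leLHS]ger0_norm ?fine_ge0 // -normrN -sub0r.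
  by near: n; exact: ac.
apply/fine_cvgP; split.
  apply: filterS (ae _ ltr01) => n an1.
  by rewrite ge0_fin_numE // (le_lt_trans an1) // ltry.
apply/cvgrPdist_le => e e0; apply: filterS (ae e e0) => n ane /=.
have anfin : a n \is a fin_num by rewrite ge0_fin_numE // (le_lt_trans ane) // ltry.
by rewrite sub0r normrN ger0_norm ?fine_ge0 // -lee_fin fineK.
Unshelve. all: by end_near.
Qed.

Section LpNorms.
Context {dT : measure_display} {T : measurableType dT} {R : realType}.
Implicit Types (f g : T -> R) (q : \bar R).
Local Open Scope ereal_scope.

Lemma measurable_abse_poweR (r : R) f : measurable_fun setT f ->
  measurable_fun setT (fun x => `|(EFin \o f) x| `^ r).
Proof.
move=> mf; rewrite (_ : (fun x => _) = EFin \o (fun x => (`|f x| `^ r)%R)) //.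
apply/measurable_EFinP.
by apply: (@measurableT_comp _ _ _ _ _ _ (@powR R ^~ r)) => //; exact: measurableT_comp.
Qed.

Section AnyMeasure.
Variable mu : {measure set T -> \bar R}.

Local Notation N q f := (Lnorm mu q (EFin \o f)).

Lemma Lnorm_ae_le q f g : 0 < q -> measurable_fun setT f -> measurable_fun setT g ->
  {ae mu, forall x, (`|f x| <= `|g x|)%R} -> N q f <= N q g.
Proof.
move=> q0 mf mg fg; rewrite unlock /Lnorm; case: q q0 => [r r0||//]; last first.
  move=> _; case: ifPn => // _; apply: le_ess_sup.
  by apply: filterS fg => x /=; rewrite lee_fin.
have r_ge0 : (0 <= r)%R by exact: ltW.
apply: gt0_ler_poweR; rewrite ?invr_ge0 //.
- by rewrite in_itv /= leey andbT integral_ge0 // => x _; exact: poweR_ge0.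
- by rewrite in_itv /= leey andbT integral_ge0 // => x _; exact: poweR_ge0.
apply: ae_ge0_le_integral => //.
- by move=> x _; exact: poweR_ge0.
- exact: measurable_abse_poweR.
- by move=> x _; exact: poweR_ge0.
- exact: measurable_abse_poweR.
apply: filterS fg => x fgx _ /=.
by rewrite lee_fin ge0_ler_powR // ?nnegrE.
Qed.

Lemma Lnorm_scale q f (k : R) : 1 <= q -> (0 < k)%R -> measurable_fun setT f ->
  N q (fun x => k * f x)%R <= k%:E * N q f.
Proof.
move=> q1 k0 mf; have [->|fy] := eqVneq (N q f) +oo.
  by rewrite gt0_muley ?lte_fin // leey.
have lf : f \in Lfun mu q.
  by rewrite inE; apply/andP; split; rewrite inE //= /finite_norm ltey.
by have := LnormZ (Lfun_Sub q1 lf) k; rewrite gtr0_norm // => <-.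
Qed.

Lemma Lnorm_ae_le_scale q f g (k : R) : 1 <= q -> (0 < k)%R ->
  measurable_fun setT f -> measurable_fun setT g ->
  {ae mu, forall x, (`|f x| <= k * `|g x|)%R} -> N q f <= k%:E * N q g.
Proof.
move=> q1 k0 mf mg fg; apply: le_trans (Lnorm_scale q1 k0 mg).
apply: Lnorm_ae_le => //; first exact: lt_le_trans q1.
  by apply: measurable_funM => //; exact: measurable_cst.
by apply: filterS fg => x; rewrite normrM gtr0_norm.
Qed.

Lemma Lnorm_triangle q f g : 1 <= q -> measurable_fun setT f -> measurable_fun setT g ->
  N q (fun x => f x + g x)%R <= N q f + N q g.
Proof. by move=> q1 mf mg; exact: eminkowski. Qed.

Lemma Lnorm_distC q f g : N q (fun x => f x - g x)%R = N q (fun x => g x - f x)%R.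
Proof.
rewrite -oppe_Lnorm; apply: eq_Lnorm => x /=.
by rewrite opprB.
Qed.

Lemma Lnorm_dist_triangle q f g (h : T -> R) : 1 <= q ->
  measurable_fun setT f -> measurable_fun setT g -> measurable_fun setT h ->
  N q (fun x => f x - h x)%R <= N q (fun x => f x - g x)%R + N q (fun x => g x - h x)%R.
Proof.
move=> q1 mf mg mh.
have := @Lnorm_triangle q (fun x => f x - g x)%R (fun x => g x - h x)%R q1
  (measurable_funB mf mg) (measurable_funB mg mh).
by under eq_Lnorm do rewrite /= subrKA.
Qed.

(** Fatou's lemma applied to [|v k|^p]. *)
Lemma Lnorm_fatou (p : R) (v : nat -> T -> R) f (e : R) : (0 < p)%R -> (0 <= e)%R ->
  (forall k, measurable_fun setT (v k)) -> measurable_fun setT f ->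
  {ae mu, forall x, (v k x @[k --> \oo] --> f x)%R} ->
  (forall k, N p%:E (v k) <= e%:E) -> N p%:E f <= e%:E.
Proof.
move=> p0 e0 mv mf vf ve.
have p_ge0 : (0 <= p)%R by exact: ltW.
have Ip k : \int[mu]_x (`|(EFin \o v k) x| `^ p) <= (e `^ p)%:E.
  rewrite -poweR_Lnorm ?gt_eqF // -poweR_EFin; apply: gt0_ler_poweR => //.
  - by rewrite in_itv /= leey andbT Lnorm_ge0.
  - by rewrite in_itv /= leey andbT lee_fin.
have If : \int[mu]_x (`|(EFin \o f) x| `^ p) <= (e `^ p)%:E.
  have F := @fatou _ T R mu setT measurableT (fun k x => `|(EFin \o v k) x| `^ p)
    (fun k => measurable_abse_poweR _ (mv k)) (fun k x _ => poweR_ge0 _ _).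
  apply: le_trans (le_trans _ F) _.
    apply: ae_ge0_le_integral => //.
    - by move=> x _; exact: poweR_ge0.
    - exact: measurable_abse_poweR.
    - move=> x _; rewrite limn_einf_lim; apply: lime_ge; first exact: is_cvg_einfs.
      by apply: nearW => n; apply: le_ereal_inf_tmp => _ [k _ <-]; exact: poweR_ge0.
    - rewrite (_ : (fun x => _) =
          -%E \o (fun x => limn_esup (fun k => - (`|(EFin \o v k) x| `^ p)))).
        apply: measurableT_comp => //.
        apply: measurable_fun_limn_esup => k.
        apply: measurableT_comp => //.
        exact: measurable_abse_poweR.
      apply/funext => x /=; rewrite -[LHS]oppeK; congr (- _); apply/esym.
      exact: (@limn_esupN R (fun k => (`|v k x| `^ p)%:E)).
    apply: filterS vf => x vfx _.
    have cv : (fun k => `|(EFin \o v k) x| `^ p) @ \oo --> `|(EFin \o f) x| `^ p.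
      rewrite (_ : (fun k => _) = EFin \o (fun k => (`|v k x| `^ p)%R)) //.
      apply: cvg_EFin; first exact: nearW.
      have cn : (fun k => `|v k x|%R) @ \oo --> `|f x|%R by exact: cvg_norm.
      exact: cvg_powR_nneg.
    by have [-> _] := cvg_limn_einf_sup cv.
  rewrite limn_einf_lim; apply: lime_le; first exact: is_cvg_einfs.
  apply: nearW => n; apply: le_trans (Ip n); apply: ereal_inf_lbound.
  by exists n => /=.
rewrite unlock /Lnorm.
have -> : e%:E = ((e `^ p)%:E) `^ p^-1.
  by rewrite poweR_EFin -powRrM mulfV ?gt_eqF // powRr1.
apply: gt0_ler_poweR => //; first by rewrite invr_ge0.
- by rewrite in_itv /= leey andbT integral_ge0 // => x _; exact: poweR_ge0.
- by rewrite in_itv /= leey andbT lee_fin powR_ge0.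
Qed.

End AnyMeasure.

Section Probability.
Variable mu : probability T R.
Local Notation N q f := (Lnorm mu q (EFin \o f)).

(** Hoelder's inequality against the constant [1], whose norm is [1] for a
    probability measure. *)
Lemma Lnorm1_le (p : R) f : (1 <= p)%R -> measurable_fun setT f -> N 1 f <= N p%:E f.
Proof.
rewrite le_eqVlt => /orP[/eqP <- //|p1 mf].
have p0 : (0 < p)%R by exact: lt_trans p1.
have q0 : (0 < (1 - p^-1)^-1)%R by rewrite invr_gt0 subr_gt0 invf_lt1.
have := @hoelder _ T R mu f (cst 1%R) p (1 - p^-1)^-1%R mf (measurable_cst _ ) p0 q0.
rewrite invrK subrKC => /(_ erefl).
rewrite Lnorm_cst1 [X in X `^ _](probability_setT mu) poweR1r mule1.
by congr (_ <= _); apply: eq_Lnorm => x /=; rewrite mulr1.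
Qed.

(** The sum of the increments is integrable, hence finite almost everywhere, and an
    absolutely convergent telescoping series converges. *)
Lemma ae_cvg_fast_Cauchy (p : R) (v : nat -> T -> R) : (1 <= p)%R ->
  (forall k, measurable_fun setT (v k)) ->
  (forall k, N p%:E (fun x => v k.+1 x - v k x)%R <= (1 / (2 ^ (k + 1))%:R)%:E) ->
  {ae mu, forall x, cvgn (fun k => v k x)}.
Proof.
move=> p1 mv Hv.
have md k : measurable_fun setT (fun x => v k.+1 x - v k x)%R by exact: measurable_funB.
pose D k (x : T) := (`|v k.+1 x - v k x|%R)%:E.
have mD k : measurable_fun setT (D k).
  by apply/measurable_EFinP; exact: measurableT_comp.
have mS : measurable_fun setT (fun x => \sum_(0 <= k <oo) D k x).
  by apply: ge0_emeasurable_sum => [k x _ _|k _]; [rewrite lee_fin|exact: mD].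
have S0 x : 0 <= \sum_(0 <= k <oo) D k x by apply: nneseries_ge0 => k _ _; rewrite lee_fin.
have intS : mu.-integrable setT (fun x => \sum_(0 <= k <oo) D k x).
  apply/integrableP; split => //.
  under eq_integral do rewrite gee0_abs //.
  rewrite integral_nneseries //; last by move=> k x _; rewrite lee_fin.
  apply: (@le_lt_trans _ _ (\sum_(0 <= k <oo) (1 / (2 ^ (k + 1))%:R)%:E)).
    apply: lee_nneseries => [k _ _|k _].
      by apply: integral_ge0 => x _; rewrite lee_fin.
    apply: le_trans (Hv k); apply: le_trans (Lnorm1_le p1 (md k)).
    by rewrite Lnorm1.
  rewrite (cvg_lim _ (@cvg_geometric_eseries_half R 1 0)) //.
  by rewrite ltry.
apply: filterS (integrable_ae measurableT intS) => x /(_ I) Sx.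
have cd : cvgn (series (fun k => v k.+1 x - v k x)%R).
  apply: normed_cvg; apply: nondecreasing_is_cvgn.
    by apply: nondecreasing_series => k _ _; exact: normr_ge0.
  exists (fine (\sum_(0 <= k <oo) D k x)) => _ [n _ <-].
  rewrite -lee_fin fineK //= /series /= -sumEFin.
  by apply: nneseries_lim_ge => k _ _; rewrite lee_fin.
have -> : (fun k => v k x) = (fun k => v 0%N x + series (fun k => v k.+1 x - v k x) k)%R.
  apply/funext => n; rewrite (eq_sum_telescope (fun k => v k x) n); congr (_ + _)%R.
by apply: is_cvgD => //; exact: is_cvg_cst.
Qed.

(** Riesz-Fischer: a Cauchy sequence in [L^p] has an a.e. convergent subsequence,
    chosen with summable increments; Fatou's lemma identifies its pointwise limit
    as the limit in [L^p]. *)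
Theorem Lp_complete (p : R) (u : nat -> T -> R) : (1 <= p)%R ->
  (forall n, measurable_fun setT (u n)) ->
  (forall e : R, (0 < e)%R -> exists n0 : nat, forall m n, (n0 <= m)%N -> (n0 <= n)%N ->
     N p%:E (fun x => u m x - u n x)%R <= e%:E) ->
  exists2 g : T -> R, measurable_fun setT g &
    N p%:E (fun x => u n x - g x)%R @[n --> \oo] --> 0.
Proof.
move=> p1 mu_ Cu.
have p0 : (0 < p)%R by exact: lt_le_trans p1.
have e0 k : (0 < 1 / (2 ^ (k + 1))%:R :> R)%R by rewrite divr_gt0 // ltr0n expn_gt0.
have /choice[n_ Hn_] := fun k => Cu _ (e0 k).
(* The successors force [idx k] to go to infinity even if [n_] is bounded. *)
pose idx k := (\sum_(i < k.+1) (n_ i).+1)%N.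
have idx_ge k : (n_ k <= idx k)%N.
  by rewrite /idx big_ord_recr /= (leq_trans (leqnSn _)) // leq_addl.
have idx_le k : (idx k <= idx k.+1)%N by rewrite /idx [leqRHS]big_ord_recr /= leq_addr.
pose v k := u (idx k).
have mv k : measurable_fun setT (v k) by exact: mu_.
have vcv : {ae mu, forall x, cvgn (fun k => v k x)}.
  apply: (ae_cvg_fast_Cauchy p1 mv) => k; apply: Hn_.
    exact: leq_trans (idx_le k).
  exact: idx_ge.
have idx_id k : (k <= idx k)%N.
  elim: k => // k IH; rewrite /idx big_ord_recr /= -/(idx k) addnS ltnS.
  by rewrite (leq_trans IH) // leq_addr.
pose g x := fine (limn_esup (fun k => (v k x)%:E)).
have mg : measurable_fun setT g.
  apply: measurableT_comp => //.
  by apply: measurable_fun_limn_esup => k; apply/measurable_EFinP.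
have vg : {ae mu, forall x, (v k x @[k --> \oo] --> g x)%R}.
  apply: filterS vcv => x cvx.
  have cE : (fun k => (v k x)%:E) @ \oo --> (limn (fun k => v k x))%:E.
    by apply: cvg_EFin; [exact: nearW|exact: cvx].
  by rewrite /g (cvg_limn_einf_sup cE).2.
exists g => //.
have small (e : R) : (0 < e)%R ->
    \forall n \near \oo, N p%:E (fun x => u n x - g x)%R <= e%:E.
  move=> e_gt0; have [n0 Hn0] := Cu e e_gt0; exists n0 => // n /= n0n.
  apply: (@Lnorm_fatou mu p (fun k x => u n x - v (k + n0)%N x)%R) => //.
  - exact: ltW.
  - by move=> k; exact: measurable_funB.
  - exact: measurable_funB.
  - apply: filterS vg => x vgx; apply: cvgB; first exact: cvg_cst.
    by move: vgx; rewrite -(cvg_shiftn n0).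
  - by move=> k; apply: Hn0 => //; rewrite (leq_trans _ (idx_id _)) // leq_addl.
by apply/ge0_cvge0P => [n|]; [exact: Lnorm_ge0|exact: small].
Qed.

End Probability.
End LpNorms.

(** * Extension of dominated operators *)

Lemma continuous_measurable_borelRd {R : realType} {d : nat} (f : 'rV[R]_d -> R) :
  continuous f -> measurable_fun [set: borelRd R d] (f : borelRd R d -> R).
Proof.
move=> /continuousP cf.
apply: (measurability _ (RGenOInfty.measurableE R)) => _ [_ [a ->] <-].
rewrite setTI; apply: sub_sigma_algebra; apply: cf; exact: interval_open.
Qed.

Lemma mem_Lfun {dT} {T : measurableType dT} {R : realType}
    (mu : {measure set T -> \bar R}) (q : \bar R) (f : T -> R) :
  f \in Lfun mu q <-> measurable_fun setT f /\ (Lnorm mu q (EFin \o f) < +oo)%E.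
Proof.
rewrite inE; split => [/andP[/set_mem mf /set_mem nf]|[mf nf]] //.
by apply/andP; split; rewrite inE.
Qed.

Section DominatedExtension.
Context {R : realType} {d : nat}.
Local Notation Rd := 'rV[R]_d.
Variables (mu nu : probability (borelRd R d) R) (p k : R).
Hypotheses (p1 : 1 <= p) (k0 : 0 < k).
Variables S U : (Rd -> R) -> Rd -> R.
Hypothesis measS : forall h, Cb h -> measurable_fun [set: borelRd R d] (S h : borelRd R d -> R).
Hypothesis measU : forall h, Cb h -> measurable_fun [set: borelRd R d] (U h : borelRd R d -> R).
Hypothesis S0 : forall x, S (fun=> 0) x = 0.
Hypothesis U0 : forall x, U (fun=> 0) x = 0.
Hypothesis dom : forall f g x, Cb f -> Cb g ->
  `|U f x - U g x| <= k * S (fun y => `|f y - g y|) x.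

Local Notation B := (borelRd R d).
Local Notation Nmu f := (Lnorm mu p%:E (EFin \o (f%R : B -> R))).
Local Notation Nnu f := (Lnorm nu p%:E (EFin \o (f%R : B -> R))).

Let p1E : (1 <= p%:E)%E. Proof. by rewrite lee_fin. Qed.

Let p0E : (0 < p%:E)%E. Proof. by rewrite lte_fin (lt_le_trans ltr01). Qed.

Let measC (h : Rd -> R) : Cb h -> measurable_fun [set: B] (h : B -> R).
Proof. by move=> [ch _]; exact: continuous_measurable_borelRd. Qed.

Lemma Cb_norm (h : Rd -> R) : Cb h -> Cb (fun x => `|h x|).
Proof.
move=> Ch; have := Cb_dist Ch (Cb_cst 0); congr Cb.
by apply/funext => x; rewrite subr0.
Qed.

Lemma Lp_cvg_norm (h : nat -> Rd -> R) (f : Rd -> R) :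
  (forall n, Cb (h n)) -> measurable_fun [set: B] (f : B -> R) ->
  Lp_cvg mu p h f -> Lp_cvg mu p (fun n x => `|h n x|) (fun x => `|f x|).
Proof.
move=> Ch mf; move=> /(ge0_cvge0P (fun n => Lnorm_ge0 _ _ _)) hf.
apply/(ge0_cvge0P (fun n => Lnorm_ge0 _ _ _)) => e e0.
apply: filterS (hf e e0) => n; apply: le_trans.
apply: (@Lnorm_ae_le _ B R mu p%:E (fun x => `|h n x| - `|f x|)
  (fun x => h n x - f x) p0E).
- by apply: measurable_funB; apply: measurableT_comp => //; exact: measC.
- by apply: measurable_funB => //; exact: measC.
- by apply: aeW => x; exact: ler_dist_dist.
Qed.

(** Uniqueness of the extension at [0] says that [S] is sequentially continuous at
    [0] for the two seminorms; a sequence of functions of norm at most [1/(n+1)]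
    whose images stay large would contradict it. *)
Lemma S_small_continuous g : Lp_extension mu nu p S (fun=> 0) g ->
  forall e : R, 0 < e -> exists2 del : R, 0 < del &
    forall h, Cb h -> (Nmu h <= del%:E)%E -> (Nnu (S h) <= e%:E)%E.
Proof.
move=> [_ /mem_Lfun[mg _] _ Hg] e e0; apply: contrapT => Hn.
have /choice[h Hh] : forall n : nat, exists h, Cb h /\ (Nmu h <= n.+1%:R^-1%:E)%E /\
    ~ (Nnu (S h) <= e%:E)%E.
  move=> n; apply: contrapT => Hn'; apply: Hn; exists n.+1%:R^-1; first by rewrite invr_gt0.
  by move=> h Ch hn; apply: contrapT => He; apply: Hn'; exists h.
have C0 : Cb (fun _ : Rd => 0 : R) := Cb_cst 0.
have h0 : Lp_cvg mu p h (fun=> 0).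
  apply/(ge0_cvge0P (fun n => Lnorm_ge0 _ _ _)) => del del0.
  near=> n.
  have -> : (fun x : B => (h n x - 0)%:E) = EFin \o (h n : B -> R).
    by apply/funext => x; rewrite subr0.
  apply: le_trans (Hh n).2.1 _; rewrite lee_fin ltW //.
  by near: n; exact: (near_infty_natSinv_lt (PosNum del0)).
have hS := Hg h (fun n => (Hh n).1) h0.
have c0 : Lp_cvg mu p (fun=> fun=> 0) (fun=> 0).
  apply/(ge0_cvge0P (fun n => Lnorm_ge0 _ _ _)) => del del0; apply: nearW => n.
  have -> : (fun x : B => (0 - 0 : R)%:E) = cst 0%E by apply/funext => x; rewrite subr0.
  by rewrite Lnorm0 ?lee_fin ?ltW // gt_eqF.
have cS := Hg _ (fun=> C0) c0.
have e20 : 0 < e / 2 by rewrite divr_gt0.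
have /(_ _ e20) nS := (ge0_cvge0P (fun n => Lnorm_ge0 _ _ _)).1 hS.
have /(_ _ e20) nc := (ge0_cvge0P (fun n => Lnorm_ge0 _ _ _)).1 cS.
have [n [Hn1 Hn2]] := filter_ex (filterI nS nc).
apply: (Hh n).2.2.
have -> : EFin \o (S (h n) : B -> R) = EFin \o (fun x : B => S (h n) x - S (fun=> 0) x).
  by apply/funext => x /=; rewrite S0 subr0.
apply: le_trans (@Lnorm_dist_triangle _ B R nu p%:E (S (h n)) g (S (fun=> 0)) p1E
  (measS (Hh n).1) mg (measS C0)) _.
rewrite (Lnorm_distC nu p%:E g) [e]splitr EFinD; exact: leeD.
Unshelve. all: by end_near.
Qed.

(** The extension inherits the pointwise domination [|U h| <= k S |h|]: along
    approximating sequences the excess [|g| - k |g'|] has a positive part of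
    arbitrarily small norm. *)
Lemma extension_dominated (f g g' : Rd -> R) (h : nat -> Rd -> R) :
  measurable_fun [set: B] (f : B -> R) -> measurable_fun [set: B] (g : B -> R) ->
  (forall n, Cb (h n)) -> Lp_cvg mu p h f -> Lp_cvg nu p (fun n => U (h n)) g ->
  Lp_extension mu nu p S (fun x => `|f x|) g' ->
  {ae nu, forall x : B, `|g x| <= k * `|g' x|}.
Proof.
move=> mf mg Ch hf Uhg [_ /mem_Lfun[mg' _] _ Hg'].
have Cah n : Cb (fun x => `|h n x|) by exact: Cb_norm.
have Shg' := Hg' _ Cah (Lp_cvg_norm Ch mf hf).
pose r (x : B) : R := Num.max 0 (`|g x| - k * `|g' x|).
have mkg' : measurable_fun [set: B] (fun x : B => k * `|g' x|).
  by apply: measurable_funM; [exact: measurable_cst|exact: measurableT_comp].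
have mr : measurable_fun setT r.
  apply: measurable_maxr; first exact: measurable_cst.
  by apply: measurable_funB => //; exact: measurableT_comp.
have Nr (e : R) : 0 < e -> (Lnorm nu p%:E (EFin \o r) <= (e + k * e)%:E)%E.
  move=> e0.
  have /(_ _ e0) nU := (ge0_cvge0P (fun n => Lnorm_ge0 _ _ _)).1 Uhg.
  have /(_ _ e0) nS := (ge0_cvge0P (fun n => Lnorm_ge0 _ _ _)).1 Shg'.
  have [n [Hn1 Hn2]] := filter_ex (filterI nU nS).
  pose F1 (x : B) : R := `|U (h n) x - g x|.
  pose F2 (x : B) : R := k * `|S (fun y => `|h n y|) x - g' x|.
  have mF1' : measurable_fun [set: B] (fun x : B => U (h n) x - g x).
    by apply: measurable_funB => //; exact: measU.
  have mF2' : measurable_fun [set: B] (fun x : B => S (fun y => `|h n y|) x - g' x).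
    by apply: measurable_funB => //; exact: measS.
  have mF1 : measurable_fun setT F1 by exact: measurableT_comp.
  have mF2 : measurable_fun setT F2.
    by apply: measurable_funM; [exact: measurable_cst|exact: measurableT_comp].
  have rF : {ae nu, forall x, `|r x| <= `|F1 x + F2 x|}.
    apply: aeW => x; have F10 : 0 <= F1 x by exact: normr_ge0.
    have F20 : 0 <= F2 x by rewrite mulr_ge0 // ltW.
    rewrite (ger0_norm (addr_ge0 F10 F20)) ger0_norm; last by rewrite le_max lexx.
    rewrite ge_max addr_ge0 //= lerBlDr.
    have Uh : `|U (h n) x| <= k * S (fun y => `|h n y|) x.
      have := dom x (Ch n) (Cb_cst 0); rewrite U0 subr0.
      by congr (_ <= _ * S _ _); apply/funext => y; rewrite subr0.
    have gF : `|g x| <= F1 x + `|U (h n) x|.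
      by rewrite /F1 distrC -lerBlDr (le_trans (lerB_dist _ _)).
    apply: le_trans gF _; rewrite -addrA lerD2l (le_trans Uh) //.
    rewrite -mulrDr ler_pM2l // -lerBlDr.
    by rewrite (le_trans _ (lerB_dist _ _)) // lerD2r ler_norm.
  apply: le_trans (Lnorm_ae_le p0E mr (measurable_funD mF1 mF2) rF) _.
  apply: le_trans (Lnorm_triangle nu p1E mF1 mF2) _.
  rewrite EFinD; apply: leeD.
    apply: le_trans Hn1; apply: (Lnorm_ae_le p0E mF1 mF1').
    by apply: aeW => x; rewrite normr_id.
  rewrite EFinM; apply: (@le_trans _ _ (k%:E * Nnu (fun x => S (fun y => `|h n y|) x - g' x))%E).
    apply: (Lnorm_ae_le_scale p1E k0 mF2 mF2').
    by apply: aeW => x; rewrite normrM normr_id gtr0_norm.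
  by rewrite lee_pmul2l.
have Nr0 : Lnorm nu p%:E (EFin \o r) = 0%E.
  apply/eqP; rewrite eq_le Lnorm_ge0 andbT; apply/lee_addgt0Pr => e e0.
  have k10 : 0 < 1 + k by rewrite addr_gt0.
  rewrite add0e; have := Nr (e / (1 + k)); rewrite divr_gt0 // => /(_ isT).
  by rewrite -[X in X + k * _]mul1r -mulrDl mulrC divfK // gt_eqF.
have mEr : measurable_fun setT (EFin \o r) by exact/measurable_EFinP.
have := Lnorm_eq0_eq0 mEr p0E Nr0.
apply: filterS => x /(_ I) [] /= rx0.
by rewrite -subr_le0 -rx0 le_max lexx orbT.
Qed.

Lemma Lnorm_extension_le (q : \bar R) (f g g' : Rd -> R) (h : nat -> Rd -> R) :
  (1 <= q)%E ->
  measurable_fun [set: B] (f : B -> R) -> measurable_fun [set: B] (g : B -> R) ->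
  (forall n, Cb (h n)) -> Lp_cvg mu p h f -> Lp_cvg nu p (fun n => U (h n)) g ->
  Lp_extension mu nu p S (fun x => `|f x|) g' ->
  (Lnorm nu q (EFin \o (g : B -> R)) <= k%:E * Lnorm nu q (EFin \o (g' : B -> R)))%E.
Proof.
move=> q1 mf mg Ch hf Uhg He.
have [_ /mem_Lfun[mg' _] _ _] := He.
exact: (Lnorm_ae_le_scale q1 k0 mg mg' (extension_dominated mf mg Ch hf Uhg He)).
Qed.

Lemma Lfun_normr (f : Rd -> R) : (f : B -> R) \in Lfun mu p%:E ->
  ((fun x => `|f x|) : B -> R) \in Lfun mu p%:E.
Proof.
move=> /mem_Lfun[mf nf]; apply/mem_Lfun; split; first exact: measurableT_comp.
apply: le_lt_trans nf; apply: (Lnorm_ae_le p0E) => //; first exact: measurableT_comp.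
by apply: aeW => x; rewrite normr_id.
Qed.

(** Continuity of [S] at [0] and the domination make [U (h m) - U (h n)] small as soon
    as [h m - h n] is, for all approximating sequences at once.  The limit then
    exists by completeness and does not depend on the sequence; it lies in
    [L^q] because the extension of [S] at [|f|] does. *)
Theorem dominated_maps_Lp_Lq (q : \bar R) : (1 <= q)%E ->
  maps_Lp_Lq mu nu p q S -> maps_Lp_Lq mu nu p q U.
Proof.
move=> q1 mapS f fL; have [mf _] := (mem_Lfun _ _ _).1 fL.
have zL : ((fun=> 0) : B -> R) \in Lfun mu p%:E by exact: Lfun_cst.
have [gz ext0 _] := mapS _ zL.
have small := S_small_continuous ext0.
have [_ [_ _ [h Ch hf] _] _] := mapS f fL.
have [g' extg' g'q] := mapS _ (Lfun_normr fL).
have diffU (h1 h2 : nat -> Rd -> R) : (forall n, Cb (h1 n)) -> (forall n, Cb (h2 n)) ->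
    Lp_cvg mu p h1 f -> Lp_cvg mu p h2 f -> forall e : R, 0 < e ->
    exists n0, forall m n, (n0 <= m)%N -> (n0 <= n)%N ->
      (Nnu (fun x => U (h1 m) x - U (h2 n) x)%R <= e%:E)%E.
  move=> C1 C2 h1f h2f e e0.
  have [del del0 Hdel] := small (e / k) (divr_gt0 e0 k0).
  have d20 : 0 < del / 2 by rewrite divr_gt0.
  have /(_ _ d20) [n1 _ N1] := (ge0_cvge0P (fun n => Lnorm_ge0 _ _ _)).1 h1f.
  have /(_ _ d20) [n2 _ N2] := (ge0_cvge0P (fun n => Lnorm_ge0 _ _ _)).1 h2f.
  exists (maxn n1 n2) => m n; rewrite !geq_max => /andP[m1 _] /andP[_ n2n].
  have C12 : Cb (fun y => `|h1 m y - h2 n y|) by exact: Cb_dist.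
  have N12 : (Nmu (fun y => `|h1 m y - h2 n y|) <= del%:E)%E.
    have md : measurable_fun [set: B] (fun y : B => h1 m y - h2 n y).
      by apply: measurable_funB; exact: measC.
    apply: (@le_trans _ _ (Nmu (fun y => h1 m y - h2 n y))).
      apply: (Lnorm_ae_le p0E) => //; first exact: measC.
      by apply: aeW => x; rewrite normr_id.
    apply: le_trans (@Lnorm_dist_triangle _ B R mu p%:E (h1 m) f (h2 n) p1E
      (measC (C1 m)) mf (measC (C2 n))) _.
    rewrite (Lnorm_distC mu p%:E f) [del]splitr EFinD.
    by apply: leeD; [exact: N1|exact: N2].
  have -> : e = k * (e / k) by rewrite mulrC divfK // gt_eqF.
  apply: (@le_trans _ _ (k%:E * Nnu (S (fun y => `|h1 m y - h2 n y|)))%E); last first.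
    by rewrite EFinM lee_pmul2l // Hdel.
  apply: (Lnorm_ae_le_scale p1E k0).
  - by apply: measurable_funB; exact: measU.
  - exact: measS.
  - apply: aeW => x; apply: le_trans (dom x (C1 m) (C2 n)) _.
    by rewrite ler_pM2l // ler_norm.
have [g mg Uhg] := @Lp_complete _ B R nu p (fun n => U (h n)) p1
  (fun n => measU (Ch n)) (diffU h h Ch Ch hf hf).
have gL r : (1 <= r)%E -> (g' : B -> R) \in Lfun nu r -> g \in Lfun nu r.
  move=> r1 /mem_Lfun[_ g'r]; apply/mem_Lfun; split => //.
  apply: le_lt_trans (Lnorm_extension_le r1 mf mg Ch hf Uhg extg') _.
  by rewrite lte_mul_pinfty // lee_fin ltW.
exists g; last exact: gL.
split => //.
- by apply: gL => //; case: extg'.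
- by exists h.
- move=> h2 C2 h2f; apply/(ge0_cvge0P (fun n => Lnorm_ge0 _ _ _)) => e e0.
  have e20 : 0 < e / 2 by rewrite divr_gt0.
  have [n0 Hn0] := diffU h2 h C2 Ch h2f hf _ e20.
  have /(_ _ e20) [n1 _ N1] := (ge0_cvge0P (fun n => Lnorm_ge0 _ _ _)).1 Uhg.
  exists n0 => // n /= n0n; pose m := maxn n0 n1.
  apply: le_trans (@Lnorm_dist_triangle _ B R nu p%:E (U (h2 n)) (U (h m)) g p1E
    (measU (C2 n)) (measU (Ch m)) mg) _.
  rewrite [e]splitr EFinD; apply: leeD.
    by apply: Hn0 => //; exact: leq_maxl.
  by apply: N1; exact: leq_maxr.
Qed.

(** The function [|f|] has the same norm as [f], so it is an admissible competitor in
    the norm of [S]. *)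
Theorem dominated_op_norm_le (q : \bar R) (K : R) : (1 <= q)%E ->
  maps_Lp_Lq mu nu p q S -> (op_norm mu nu p q S <= K%:E)%E ->
  (op_norm mu nu p q U <= (K * k)%:E)%E.
Proof.
move=> q1 mapS opS; apply: ge_ereal_sup => _ [f [g [f1 [fL gL [h Ch hf] Hg] ->]]].
have [mf _] := (mem_Lfun _ _ _).1 fL; have [mg _] := (mem_Lfun _ _ _).1 gL.
have [g' extg' _] := mapS _ (Lfun_normr fL).
apply: le_trans (Lnorm_extension_le q1 mf mg Ch hf (Hg h Ch hf) extg') _.
rewrite mulrC EFinM lee_pmul2l //; apply: le_trans opS; apply: ereal_sup_ubound.
exists (fun x => `|f x|), g'; split => //.
apply: le_trans f1; apply: (Lnorm_ae_le p0E) => //; first exact: measurableT_comp.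
by apply: aeW => x; rewrite normr_id.
Qed.

End DominatedExtension.

(** * Contractivity estimates *)

(** A lower bound for the factor near [0] keeps the product divergent there. *)
Lemma rate_function_mul {R : realType} (tau : \bar R) (C D : R -> R) :
  rate_function +oo C -> (forall r, 0 < r -> 0 < D r) ->
  (forall r r', 0 < r -> r <= r' -> D r' <= D r) ->
  (exists2 m : R, 0 < m & forall r, 0 < r -> r <= 1 -> m <= D r) ->
  rate_function tau (fun r => C r * D r).
Proof.
move=> [C0 Cle Cy] D0 Dle [m m0 Dm]; split.
- by move=> r r0; rewrite mulr_gt0 ?C0 ?D0.
- move=> r r' r0 rr' _; have r'0 : 0 < r' by exact: lt_le_trans rr'.
  apply: ler_pM; [exact/ltW/C0|exact/ltW/D0|apply: Cle => //|exact: Dle].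
  exact: ltry.
- apply/cvgryPge => A; move/cvgryPge: Cy => /(_ (`|A| / m)) CA.
  near=> r.
  have r0 : 0 < r by near: r; exact: nbhs_right_gt.
  have r1 : r <= 1 by near: r; exact: nbhs_right_le.
  apply: le_trans (ler_norm A) _.
  have -> : `|A| = (`|A| / m) * m by rewrite divfK // gt_eqF.
  apply: ler_pM => //; first by rewrite divr_ge0 // ltW.
  + exact: ltW.
  + by near: r.
  + exact: Dm.
Unshelve. all: by end_near.
Qed.

Section Contractivity.
Context {R : realType} {d : nat}.
Variables (E : R -> \bar R -> Prop) (i0 c0 : R).
Variable mu : R -> probability (borelRd R d) R.
Variable Gc : R -> R -> ('rV[R]_d -> R) -> 'rV[R]_d -> R.

(** For [c0 >= 0] the factor [e^{-c0 r}] is itself nonincreasing.  On a bounded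
    horizon [r < T] the constant [e^{|c0| |T|}] dominates it for either sign of
    [c0]. *)
Lemma norm_bound_contractive (C : R -> \bar R -> R -> R) :
  (forall p q, E p q -> rate_function +oo (C p q)) ->
  norm_bound E i0 mu Gc (fun p q r => C p q r * expR (- c0 * r)) ->
  (0 <= c0 -> contractive_upto E i0 mu +oo%E Gc) /\
  (forall T : R, contractive_upto E i0 mu T%:E Gc).
Proof.
move=> rC nb; split=> [c00|T].
  exists (fun p q r => C p q r * expR (- c0 * r)) => p q Epq; split; last first.
    by move=> s t i0s st _; exact: nb.
  apply: rate_function_mul; first exact: rC.
  - by move=> r _; exact: expR_gt0.
  - move=> r r' _ rr'; rewrite /= ler_expR !mulNr lerN2; exact: ler_wpM2l.
  - exists (expR (- c0)); first exact: expR_gt0.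
    by move=> r _ r1; rewrite /= ler_expR mulNr lerN2 ler_piMr.
exists (fun p q r => C p q r * expR (`|c0| * `|T|)) => p q Epq; split.
  apply: (@rate_function_mul _ _ _ (fun=> expR (`|c0| * `|T|))) => //; first exact: rC.
  by exists (expR (`|c0| * `|T|)); first exact: expR_gt0.
move=> s t i0s st; rewrite lte_fin => tsT; have [mapU opU] := nb p q s t Epq i0s st.
split => //; apply: le_trans opU _.
have [C0 _ _] := rC p q Epq.
have Cts : 0 < C p q (t - s) by apply: C0; rewrite subr_gt0.
rewrite lee_fin ler_pM2l // ler_expR.
have ts0 : 0 <= t - s by rewrite subr_ge0 ltW.
apply: le_trans (ler_norm _) _; rewrite normrM normrN ler_wpM2l //.
by rewrite ger0_norm // (le_trans (ltW tsT)) // ler_norm.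
Qed.

End Contractivity.

Section EvolutionContractivity.
Context {R : realType} {d : nat}.
Variables (i0 alpha : R) (Q : R -> 'M[R]_d) (b : R -> 'rV[R]_d -> 'rV[R]_d).
Hypothesis hA : standing_assumptions i0 alpha Q b.
Variables (c : R -> 'rV[R]_d -> R) (c0 : R).
Hypothesis hc0 : ereal_inf [set y | exists t x, i0 < t /\ y = (c t x)%:E] = c0%:E.
Variable G : R -> R -> ('rV[R]_d -> R) -> 'rV[R]_d -> R.
Hypothesis hG : is_evolution_G i0 alpha Q b G.
Variable Gc : R -> R -> ('rV[R]_d -> R) -> 'rV[R]_d -> R.
Hypothesis hGc : is_evolution_Gc i0 alpha Q b c c0 Gc.
Variable mu : R -> probability (borelRd R d) R.

Lemma c0_le t x : i0 < t -> c0 <= c t x.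
Proof.
by move=> it; rewrite -lee_fin -hc0; apply: ereal_inf_lbound; exists t, x.
Qed.

Theorem evolution_norm_bound (E : R -> \bar R -> Prop) (C : R -> \bar R -> R -> R) :
  (forall p q, E p q -> 1 <= p /\ (1 <= q)%E) ->
  contractive_with E i0 mu +oo%E G C ->
  norm_bound E i0 mu Gc (fun p q r => C p q r * expR (- c0 * r)).
Proof.
move=> E1 contG p q s t Epq i0s st; have [p1 q1] := E1 p q Epq.
have [_ /(_ s t i0s st (ltry _)) [mapG opG]] := contG p q Epq.
have al0 : 0 < alpha by have /andP[] := sa_alpha hA.
have st' : s <= t by exact: ltW.
have mG h : Cb h -> measurable_fun [set: borelRd R d] (G t s h : borelRd R d -> R).
  move=> Ch; apply: continuous_measurable_borelRd.
  exact: (classical_solution_slice_continuous al0 (hG i0s Ch).1 st).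
have mGc h : Cb h -> measurable_fun [set: borelRd R d] (Gc t s h : borelRd R d -> R).
  move=> Ch; apply: continuous_measurable_borelRd.
  exact: (classical_solution_slice_continuous al0 (hGc i0s Ch).1 st).
have G0 x := evolution_0 hA hG x i0s st'.
have Gc0 x := evolution_c_0 hGc x i0s st'.
have dom f g x (Cf : Cb f) (Cg : Cb g) :=
  evolution_comparison hA hG c0_le hGc x i0s st' Cf Cg.
have k0 : 0 < expR (- c0 * (t - s)) by exact: expR_gt0.
split.
  exact: (dominated_maps_Lp_Lq p1 k0 mG mGc G0 Gc0 dom q1 mapG).
exact: (dominated_op_norm_le p1 k0 mG mGc Gc0 dom q1 mapG opG).
Qed.

Theorem evolution_contractive (E : R -> \bar R -> Prop) (C : R -> \bar R -> R -> R) :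
  (forall p q, E p q -> 1 <= p /\ (1 <= q)%E) ->
  contractive_with E i0 mu +oo%E G C ->
  [/\ 0 <= c0 -> contractive_upto E i0 mu +oo%E Gc,
      forall T : R, contractive_upto E i0 mu T%:E Gc &
      norm_bound E i0 mu Gc (fun p q r => C p q r * expR (- c0 * r))].
Proof.
move=> E1 contG; have nb := evolution_norm_bound E1 contG.
have rC p q : E p q -> rate_function +oo (C p q) by move=> /contG[].
by have [] := norm_bound_contractive rC nb.
Qed.

End EvolutionContractivity.

Theorem theorem5p6 (R : realType) (d : nat) (hd : (0 < d)%N) (i0 alpha : R)
  (Q : R -> 'M[R]_d) (b : R -> 'rV[R]_d -> 'rV[R]_d)
  (hA : standing_assumptions i0 alpha Q b)
  (c : R -> 'rV[R]_d -> R) (c0 : R)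
  (hc : parabolic_holder_loc i0 alpha c)
  (hc0 : ereal_inf [set y | exists t x, i0 < t /\ y = (c t x)%:E] = c0%:E)
  (G : R -> R -> ('rV[R]_d -> R) -> 'rV[R]_d -> R)
  (hG : is_evolution_G i0 alpha Q b G)
  (Gc : R -> R -> ('rV[R]_d -> R) -> 'rV[R]_d -> R)
  (hGc : is_evolution_Gc i0 alpha Q b c c0 Gc)
  (mu : R -> probability (borelRd R d) R)
  (hmu : tight_evolution_system i0 G mu) :
  (forall C, contractive_with supercontractive_exp i0 mu +oo%E G C ->
    [/\ 0 <= c0 -> supercontractive i0 mu Gc,
        locally_supercontractive i0 mu Gc &
        norm_bound supercontractive_exp i0 mu Gc
          (fun p q r => C p q r * expR (- c0 * r))]) /\
  (forall C, contractive_with ultrabounded_exp i0 mu +oo%E G C ->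
    [/\ 0 <= c0 -> ultrabounded i0 mu Gc,
        locally_ultrabounded i0 mu Gc &
        norm_bound ultrabounded_exp i0 mu Gc
          (fun p q r => C p q r * expR (- c0 * r))]) /\
  (forall C, contractive_with ultracontractive_exp i0 mu +oo%E G C ->
    [/\ 0 <= c0 -> ultracontractive i0 mu Gc,
        locally_ultracontractive i0 mu Gc &
        norm_bound ultracontractive_exp i0 mu Gc
          (fun p q r => C p q r * expR (- c0 * r))]).
Proof.
split; [|split] => C contG; apply: (evolution_contractive hA hc0 hG hGc _ contG) => p q.
- by move=> [p1 pq _]; split; [exact: ltW|rewrite (le_trans _ (ltW pq)) // lee_fin ltW].
- by move=> [p1 ->]; split; [exact: ltW|exact: leey].
- by move=> [p1 ->]; split; [|exact: leey].
Qed.
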